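(* For any instance $(k,X,\Omega,\mathcal{A},\mathrm{K})$ of weight-constrained anisotropic clustering, any $\epsilon\in(0,\tfrac12]$ and any $\delta\ge\lambda^+(\mathcal{A})/\lambda^-(\mathcal{A})$, there is an $(\epsilon,\delta)$-coreset for $(k,X,\Omega,\mathcal{A},\mathrm{K})$ of size $\tilde n\in\mathcal{O}\!\left(\frac{k^2}{\epsilon^{d+1}}\right)$, where the $\mathcal{O}$-notation refers to $k\to\infty$ and $\epsilon\to0$ for fixed dimension $d$, and the bound does not depend on the number $n$ of points of $X$.
   Context: Fix $d,k\in\mathbb{N}$. A weighted data set $(X,\Omega)$ consists of a finite family $X=\{x_1,\dots,x_n\}$ of points of $\mathbb{R}^d$ (repetitions allowed) and weights $\Omega=\{\omega_1,\dots,\omega_n\}$ with $\omega_j>0$; its size is the number of points. A $k$-clustering of $(X,\Omega)$ is a vector $C=(\xi_{ij})_{i\in[k],j\in[n]}$ with $\xi_{ij}\ge0$ and $\sum_{i=1}^k\xi_{ij}=1$ for all $j$; cluster $i$ has weight $\omega(C_i)=\sum_j\xi_{ij}\omega_j$. Weight bounds $\mathrm{K}=\{\kappa_1^-,\kappa_1^+,\dots,\kappa_k^-,\kappa_k^+\}$, $\kappa_i^-\le\kappa_i^+\in\mathbb{R}\cup\{\infty\}$; $\mathcal{C}_\mathrm{K}(k,X,\Omega)$ is the set of $k$-clusterings with $\kappa_i^-\le\omega(C_i)\le\kappa_i^+$ for all $i$, assumed nonempty. $\mathcal{A}=\{A_1,\dots,A_k\}$ symmetric positive definite $d\times d$ matrices,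 $\|x\|_A^2=x^\top Ax$, $\lambda^+(\mathcal{A}),\lambda^-(\mathcal{A})$ the largest and smallest eigenvalue over all matrices in $\mathcal{A}$. For sites $S=\{s_1,\dots,s_k\}\subset\mathbb{R}^d$: $\operatorname{cost}_{\mathcal{A},\mathrm{K}}(X,C,S)=\sum_{i,j}\xi_{ij}\omega_j\|x_j-s_i\|_{A_i}^2$ and $\operatorname{cost}_{\mathcal{A},\mathrm{K}}(X,S)=\min_{C\in\mathcal{C}_\mathrm{K}(k,X,\Omega)}\operatorname{cost}_{\mathcal{A},\mathrm{K}}(X,C,S)$. An instance is a tuple $(k,X,\Omega,\mathcal{A},\mathrm{K})$. Coreset: for $\epsilon\in(0,\tfrac12]$, $\delta\in[1,\infty)$, a weighted data set $(\tilde X,\tilde\Omega)$ is an $(\epsilon,\delta)$-coreset for $(k,X,\Omega,\mathcal{A},\mathrm{K})$ if there exist a map $f:\mathcal{C}_\mathrm{K}(k,\tilde X,\tilde\Omega)\to\mathcal{C}_\mathrm{K}(k,X,\Omega)$ and reals $\Delta^+,\Delta^-$ with $0\le\Delta^+\le\delta\Delta^-$ such that for all sets $S$ of $k$ sites and all $\tilde C\in\mathcal{C}_\mathrm{K}(k,\tilde X,\tilde\Omega)$: (a) $(1-\epsilon)\operatorname{cost}_{\mathcal{A},\mathrm{K}}(X,f(\tilde C),S)\le\operatorname{cost}_{\mathcal{A},\mathrm{K}}(\tilde X,\tilde C,S)+\Delta^+$, (b) $\operatorname{cost}_{\mathcal{A},\mathrm{K}}(\tilde X,S)+\Delta^-\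le(1+\epsilon)\operatorname{cost}_{\mathcal{A},\mathrm{K}}(X,S)$.
   Formalization: The O-constant depends on d and, through a nondecreasing function, on the ratio λ⁺(A)/λ⁻(A); a constant depending on d alone is impossible (d=1, k=2, A=(1,L), fine grid of [0,1], cluster 2 of weight L^(-1/3) needs about L^(1/3) points). *)

(* Defs.v *)
From HB Require Import structures.
From mathcomp Require Import all_boot all_order all_algebra.
From mathcomp Require Import all_classical all_reals.

Set Implicit Arguments.
Unset Strict Implicit.
Unset Printing Implicit Defensive.

Import Order.TTheory GRing.Theory Num.Theory.
Local Open Scope classical_set_scope.
Local Open Scope ring_scope.

(* Points are indexed, so repetitions are allowed. *)
Record weighted_data (R : realType) (d : nat) := WeightedData {
  wd_size : nat ;
  wd_point : 'I_wd_size -> 'cV[R]_d ;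
  wd_weight : 'I_wd_size -> R ;
  wd_weight_gt0 : forall j, 0 < wd_weight j }.

Definition sqnorm_mx (R : realType) (d : nat) (A : 'M[R]_d) (x : 'cV[R]_d) : R :=
  (x^T *m A *m x) ord0 ord0.

Definition sym_posdef (R : realType) (d : nat) (A : 'M[R]_d) : Prop :=
  A^T = A /\ forall x : 'cV[R]_d, x != 0 -> 0 < sqnorm_mx A x.

(* For symmetric matrices with 0 < d and 0 < k this set of real eigenvalues is
   finite and nonempty, so the sup and inf below are its maximum and minimum. *)
Definition spectrum (R : realType) (d k : nat) (A : 'I_k -> 'M[R]_d) : set R :=
  [set a | exists i, eigenvalue (A i) a].

Definition lambda_max (R : realType) (d k : nat) (A : 'I_k -> 'M[R]_d) : R :=
  sup (spectrum A).

Definition lambda_min (R : realType) (d k : nat) (A : 'I_k -> 'M[R]_d) : R :=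
  inf (spectrum A).

Definition is_clustering (R : realType) (k n : nat) (C : 'M[R]_(k, n)) : Prop :=
  (forall i j, 0 <= C i j) /\ (forall j, \sum_(i < k) C i j = 1).

Definition cluster_weight (R : realType) (d k : nat) (X : weighted_data R d)
    (C : 'M[R]_(k, wd_size X)) (i : 'I_k) : R :=
  \sum_(j < wd_size X) C i j * wd_weight j.

(* Bounds live in R together with +oo: -oo is excluded, and the lower bound is
   not required to be finite or nonnegative. *)
Definition weight_bounds (R : realType) (k : nat) (Kmin Kmax : 'I_k -> \bar R) : Prop :=
  forall i, (-oo < Kmin i)%E /\ (Kmin i <= Kmax i)%E.

Definition clusterings (R : realType) (d k : nat) (Kmin Kmax : 'I_k -> \bar R)
    (X : weighted_data R d) : set 'M[R]_(k, wd_size X) :=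
  [set C | is_clustering C /\
     forall i, (Kmin i <= (cluster_weight C i)%:E)%E /\
               ((cluster_weight C i)%:E <= Kmax i)%E].
Arguments clusterings {R d k} Kmin Kmax X _.

Definition cost_at (R : realType) (d k : nat) (A : 'I_k -> 'M[R]_d)
    (X : weighted_data R d) (C : 'M[R]_(k, wd_size X)) (S : 'I_k -> 'cV[R]_d) : R :=
  \sum_(i < k) \sum_(j < wd_size X)
    C i j * wd_weight j * sqnorm_mx (A i) (wd_point j - S i).

(* The set of admissible clusterings is compact, hence the inf is a minimum as
   soon as that set is nonempty; inf set0 = 0 is a junk value. *)
Definition cost (R : realType) (d k : nat) (A : 'I_k -> 'M[R]_d)
    (Kmin Kmax : 'I_k -> \bar R) (X : weighted_data R d) (S : 'I_k -> 'cV[R]_d) : R :=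
  inf [set cost_at A C S | C in clusterings Kmin Kmax X].

(* Nonemptiness of clusterings Kmin Kmax Y is the standing feasibility
   assumption, needed for the minimum over Y to make sense. The map f may not
   depend on the sites; its values outside clusterings Kmin Kmax Y are
   irrelevant. *)
Definition is_coreset (R : realType) (d k : nat) (eps delta : R)
    (A : 'I_k -> 'M[R]_d) (Kmin Kmax : 'I_k -> \bar R) (X Y : weighted_data R d) : Prop :=
  clusterings Kmin Kmax Y !=set0 /\
  exists (f : 'M[R]_(k, wd_size Y) -> 'M[R]_(k, wd_size X)) (Dplus Dminus : R),
    [/\ forall C, clusterings Kmin Kmax Y C -> clusterings Kmin Kmax X (f C),
        0 <= Dplus <= delta * Dminus &
        forall (S : 'I_k -> 'cV[R]_d) (C : 'M[R]_(k, wd_size Y)),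
          clusterings Kmin Kmax Y C ->
          (1 - eps) * cost_at A (f C) S <= cost_at A C S + Dplus /\
          cost A Kmin Kmax Y S + Dminus <= (1 + eps) * cost A Kmin Kmax X S].

(* Main.v *)
Require Import Defs.
From HB Require Import structures.
From mathcomp Require Import all_boot all_order all_algebra.
From mathcomp Require Import all_classical all_reals.
From mathcomp Require Import topology normedtype derive.
From mathcomp Require Import ring lra zify.

Set Implicit Arguments.
Unset Strict Implicit.
Unset Printing Implicit Defensive.

Import Order.TTheory GRing.Theory Num.Theory.
Import numFieldNormedType.Exports.
Local Open Scope classical_set_scope.
Local Open Scope ring_scope.

(* Replacing a batch of points by its weighted centroid changes the cost of a
   clustering that is constant on the batch by an amount independent of the
   sites, so any partition into batches satisfies inequality (a), with Dplus and
   Dminus equal to lambda_max and lambda_min times the total variance of the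
   batches. A batch lying in a single cluster satisfies (b) as well, and only the
   batches meeting several clusters cost an error, of order 1/eps times their
   variance.
   To keep the latter under control, take k data points that are 4-optimal centres
   for unconstrained Euclidean k-means and move every point by O(eps) times its
   distance to its centre onto one of O(1/eps^(d-1)) lines through that centre.
   Cut each line into O(k/eps^2) intervals, each carrying O(eps^2/k) of the
   variance of the line. On a line the costs of the sites are quadratics, so an
   optimal clustering shows no alternation a b a b of two clusters, and the
   Davenport-Schinzel bound leaves only O(k) intervals meeting several clusters.
   The total is k * eps^-(d-1) * k * eps^-2 batches. *)

(** * Quadratic forms and their extreme eigenvalues *)

Section QuadraticForms.
Variables (R : realType) (d : nat).
Implicit Types (A : 'M[R]_d) (x y z : 'cV[R]_d).

Definition bilin A x y : R := (x^T *m A *m y) ord0 ord0.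

Lemma sqnorm_bilin A x : sqnorm_mx A x = bilin A x x. Proof. by []. Qed.

Lemma bilinE A x y :
  bilin A x y = \sum_a \sum_b x a ord0 * A a b * y b ord0.
Proof.
rewrite /bilin mxE exchange_big; apply: eq_bigr => b _.
by rewrite !mxE big_distrl; apply: eq_bigr => a _; rewrite !mxE.
Qed.

Lemma bilinDl A x y z : bilin A (x + y) z = bilin A x z + bilin A y z.
Proof. by rewrite /bilin linearD !mulmxDl mxE. Qed.

Lemma bilinDr A x y z : bilin A z (x + y) = bilin A z x + bilin A z y.
Proof. by rewrite /bilin mulmxDr mxE. Qed.

Lemma bilinZl A (a : R) x y : bilin A (a *: x) y = a * bilin A x y.
Proof. by rewrite /bilin linearZ -!scalemxAl mxE. Qed.

Lemma bilinZr A (a : R) x y : bilin A x (a *: y) = a * bilin A x y.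
Proof. by rewrite /bilin -scalemxAr mxE. Qed.

Lemma bilinC A x y : A^T = A -> bilin A x y = bilin A y x.
Proof.
move=> As; rewrite !bilinE exchange_big; apply: eq_bigr => b _.
apply: eq_bigr => a _; rewrite -{1}As mxE; ring.
Qed.

Lemma bilin_suml A (I : finType) (P : pred I) (w : I -> R) (f : I -> 'cV[R]_d) y :
  \sum_(j | P j) w j * bilin A (f j) y = bilin A (\sum_(j | P j) w j *: f j) y.
Proof.
elim/big_rec2: _ => [|j a b _ ->]; last by rewrite bilinDl bilinZl.
by rewrite /bilin trmx0 !mul0mx mxE.
Qed.

Lemma sqnormD A x y : A^T = A ->
  sqnorm_mx A (x + y) = sqnorm_mx A x + bilin A x y *+ 2 + sqnorm_mx A y.
Proof.
move=> As; rewrite !sqnorm_bilin !bilinDl !bilinDr (bilinC y x As); ring.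
Qed.

Lemma sqnormZ A a x : sqnorm_mx A (a *: x) = a ^+ 2 * sqnorm_mx A x.
Proof. rewrite !sqnorm_bilin bilinZl bilinZr; ring. Qed.

Lemma sqnorm0 A : sqnorm_mx A 0 = 0.
Proof. by rewrite /sqnorm_mx mulmx0 mxE. Qed.

Lemma sqnorm1E x : sqnorm_mx 1%:M x = \sum_a x a ord0 ^+ 2.
Proof.
rewrite /sqnorm_mx mulmx1 mxE; apply: eq_bigr => a _.
by rewrite mxE expr2.
Qed.

Lemma sqnorm1_ge0 x : 0 <= sqnorm_mx 1%:M x.
Proof. by rewrite sqnorm1E sumr_ge0 // => a _; exact: sqr_ge0. Qed.

Lemma sqnorm1_eq0 x : sqnorm_mx 1%:M x = 0 -> x = 0.
Proof.
rewrite sqnorm1E => /eqP; rewrite psumr_eq0 => [/allP h|a _]; last exact: sqr_ge0.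
apply/colP => a; rewrite mxE; apply/eqP; rewrite -sqrf_eq0.
exact: h (mem_index_enum a).
Qed.

(** Nonnegativity of the form at [al *: x - y], divided by [al], bounds the cross term. *)
Lemma sqnorm_young A (al : R) x y : A^T = A -> (forall z, 0 <= sqnorm_mx A z) ->
  0 < al ->
  sqnorm_mx A (x + y) <= (1 + al) * sqnorm_mx A x + (1 + al^-1) * sqnorm_mx A y.
Proof.
move=> As Ap al0; have := Ap (al *: x + (- 1) *: y).
rewrite sqnormD // (sqnormD _ _ As) !sqnormZ bilinZl bilinZr => h.
have {}h : 0 <= al^-1 * (al ^+ 2 * sqnorm_mx A x +
    al * (-1 * bilin A x y) *+ 2 + (-1) ^+ 2 * sqnorm_mx A y).
  by rewrite mulr_ge0 // invr_ge0 ltW.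
rewrite -subr_ge0; apply: le_trans h _; rewrite le_eqVlt; apply/orP; left.
by apply/eqP; field; rewrite gt_eqF.
Qed.

Lemma sqnorm_sub_mx A (a : R) x :
  sqnorm_mx (A - a%:M) x = sqnorm_mx A x - a * sqnorm_mx 1%:M x.
Proof.
by rewrite /sqnorm_mx mulmxBr mulmxBl mul_mx_scalar mulmx1 -scalemxAl !mxE.
Qed.

Lemma continuous_sqnorm A :
  continuous (fun v : 'rV[R]_d => sqnorm_mx A v^T : R^o).
Proof.
rewrite (_ : (fun v => _) =
  (fun v : 'rV[R]_d => \sum_a \sum_b v ord0 a * A a b * v ord0 b : R^o)).
  apply: continuous_big => //; first exact: add_continuous.
  move=> a _; apply: continuous_big => //; first exact: add_continuous.
  move=> b _; have cc i : continuous (fun w : 'rV[R]_d => w ord0 i : R^o).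
    exact: coord_continuous.
  move=> v; apply: (@cvgM R _ (nbhs v) _ (fun w : 'rV[R]_d => w ord0 a * A a b)
    (fun w : 'rV[R]_d => w ord0 b)); last exact: cc.
  by apply: (@cvgMr_tmp R _ (nbhs v) _ (fun w : 'rV[R]_d => w ord0 a)); exact: cc.
apply/funext => v; rewrite sqnorm_bilin bilinE.
by apply: eq_bigr => a _; apply: eq_bigr => b _; rewrite !mxE.
Qed.

(** The form attains its minimum [m] on the compact unit sphere, at [v] say. Then [B = A - m] is
    positive semidefinite and vanishes at [v], which forces [v] into its kernel, so [m] is an
    eigenvalue. *)
Lemma rayleigh_min A : (0 < d)%N -> A^T = A ->
  exists2 m : R, eigenvalue A m &
    forall x, m * sqnorm_mx 1%:M x <= sqnorm_mx A x.
Proof.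
move=> d0 As.
(* The sphere is presented as a closed subset of a cube, which yields its compactness. *)
pose sph := [set v : 'rV[R]_d | forall i, `[-1, 1]%classic (v ord0 i)] `&`
            ((fun v : 'rV[R]_d => sqnorm_mx 1%:M v^T : R^o) @^-1` [set x | x = 1]).
have sphE v : sqnorm_mx 1%:M v^T = 1 -> sph v.
  move=> v1; split=> //= i; rewrite in_itv/=.
  have : v ord0 i ^+ 2 <= 1.
    rewrite -v1 sqnorm1E (bigD1 i) //= mxE lerDl.
    by rewrite sumr_ge0 // => a _; exact: sqr_ge0.
  by move=> h; apply/andP; split; nra.
have csph : compact sph.
  apply: compact_closedI.
    by apply: (@rV_compact R d (fun=> `[-1, 1]%classic)) => i; exact: segment_compact.
  by apply: preimage_closed => [v _|]; [exact: continuous_sqnorm|exact: closed_eq].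
have sph0 : sph !=set0.
  exists (delta_mx ord0 (Ordinal d0)); apply: sphE.
  rewrite sqnorm1E (bigD1 (Ordinal d0)) //= !mxE !eqxx expr1n big1 ?addr0 //.
  by move=> a ane; rewrite !mxE eqxx (negPf ane) expr0n.
have [] := @EVT_min_rV R d (fun v => sqnorm_mx A v^T) sph sph0 csph.
  by apply: continuous_subspaceT => v; exact: continuous_sqnorm.
move=> v; rewrite inE => -[_ /= v1] vmin.
have low x : sqnorm_mx A v^T * sqnorm_mx 1%:M x <= sqnorm_mx A x.
  have [->|xn] := eqVneq x 0.
    by rewrite !sqnorm0 mulr0.
  have q0 : 0 < sqnorm_mx 1%:M x.
    rewrite lt_neqAle sqnorm1_ge0 andbT eq_sym; apply/eqP => /sqnorm1_eq0 x0.
    by rewrite x0 eqxx in xn.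
  set r := sqnorm_mx _ x in q0 *; have s0 : 0 < Num.sqrt r by rewrite sqrtr_gt0.
  have rE : (Num.sqrt r)^-1 ^+ 2 = r^-1 by rewrite exprVn sqr_sqrtr // ltW.
  have := vmin ((Num.sqrt r)^-1 *: x)^T; rewrite inE trmxK => /(_ _).
  rewrite sqnormZ rE ler_pdivlMl // mulrC; apply.
  by apply: sphE; rewrite trmxK sqnormZ rE mulVf // gt_eqF.
exists (sqnorm_mx A v^T) => //; set m := sqnorm_mx A v^T.
apply/eigenvalueP; exists v; last first.
  apply/eqP => v0; move/eqP: v1; rewrite v0 sqnorm1E big1 ?(eq_sym 0) ?oner_eq0 //.
  by move=> a _; rewrite !mxE expr0n.
pose B := A - m%:M; have Bs : B^T = B by rewrite /B linearB /= As tr_scalar_mx.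
have Bp x : 0 <= sqnorm_mx B x by rewrite sqnorm_sub_mx subr_ge0.
have Bv : sqnorm_mx B v^T = 0 by rewrite sqnorm_sub_mx v1 mulr1 subrr.
have Bo y : bilin B v^T y = 0.
  set b := bilin B v^T y; set c := sqnorm_mx B y.
  have h t : 0 <= t * b *+ 2 + t ^+ 2 * c.
    by have := Bp (v^T + t *: y); rewrite sqnormD // Bv add0r bilinZr sqnormZ.
  have c0 : 0 <= c by exact: Bp.
  (* Nearly the minimiser [- b / c] of the quadratic in [t]; the denominator [c + 1] also covers
     [c = 0]. *)
  have := h (- b / (c + 1)).
  have -> : - b / (c + 1) * b *+ 2 + (- b / (c + 1)) ^+ 2 * c =
    - (b / (c + 1)) ^+ 2 * (c + 2%:R).
    by field; rewrite gt_eqF //; lra.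
  rewrite mulNr oppr_ge0 pmulr_lle0; last by lra.
  move=> h2; apply/eqP; have : (b / (c + 1)) ^+ 2 == 0 by rewrite eq_le h2 sqr_ge0.
  by rewrite sqrf_eq0 mulf_eq0 invr_eq0 => /orP[//|]; rewrite gt_eqF //; lra.
apply/eqP; rewrite -subr_eq0 -mul_mx_scalar -mulmxBr -/B; apply/eqP/rowP => i.
have := Bo (delta_mx i ord0); rewrite /bilin trmxK -colE mxE => ->.
by rewrite mxE.
Qed.

Lemma rayleigh_max A : (0 < d)%N -> A^T = A ->
  exists2 m : R, eigenvalue A m &
    forall x, sqnorm_mx A x <= m * sqnorm_mx 1%:M x.
Proof.
move=> d0 As; have As' : (- A)^T = - A by rewrite linearN /= As.
have [m em hm] := rayleigh_min d0 As'; exists (- m).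
  move/eigenvalueP: em => [v vA v0]; apply/eigenvalueP; exists v => //.
  by rewrite scaleNr -vA mulmxN opprK.
move=> x; have := hm x; rewrite /sqnorm_mx mulmxN mulNmx [X in _ <= X]mxE.
by rewrite mulNr lerNr.
Qed.

Lemma eigenvalue_ge A (m a : R) :
  (forall x, m * sqnorm_mx 1%:M x <= sqnorm_mx A x) -> eigenvalue A a -> m <= a.
Proof.
move=> h /eigenvalueP[v vA v0]; have := h v^T.
rewrite {2}/sqnorm_mx trmxK vA -scalemxAl mxE.
have -> : (v *m v^T) ord0 ord0 = sqnorm_mx 1%:M v^T.
  by rewrite /sqnorm_mx trmxK mulmx1.
rewrite ler_pM2r // lt_neqAle sqnorm1_ge0 andbT eq_sym.
apply/eqP => /sqnorm1_eq0 /(congr1 trmx); rewrite trmxK trmx0 => vz.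
by rewrite vz eqxx in v0.
Qed.

Lemma eigenvalue_le A (m a : R) :
  (forall x, sqnorm_mx A x <= m * sqnorm_mx 1%:M x) -> eigenvalue A a -> a <= m.
Proof.
move=> h /eigenvalueP[v vA v0]; rewrite -lerN2.
apply: (@eigenvalue_ge (- A)) => [x|].
  have := h x; rewrite /sqnorm_mx mulmxN mulNmx [X in _ -> _ <= X]mxE.
  by rewrite mulNr lerN2.
by apply/eigenvalueP; exists v => //; rewrite mulmxN vA scaleNr.
Qed.

End QuadraticForms.

(** The optimal Rayleigh bounds [m i] and [M i] are themselves eigenvalues. Hence the spectrum is
    nonempty and bounded, and its infimum and supremum inherit the bounds on the forms. *)
Lemma spectrum_bounds (R : realType) (d k : nat) (A : 'I_k -> 'M[R]_d) :
  (0 < d)%N -> (0 < k)%N -> (forall i, sym_posdef (A i)) ->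
  [/\ 0 < lambda_min A, lambda_min A <= lambda_max A &
    forall i x, lambda_min A * sqnorm_mx 1%:M x <= sqnorm_mx (A i) x /\
                sqnorm_mx (A i) x <= lambda_max A * sqnorm_mx 1%:M x].
Proof.
move=> d0 k0 Apd; pose i0 := Ordinal k0.
have /choice[m hm] : forall i, exists m : R, eigenvalue (A i) m /\
    forall x, m * sqnorm_mx 1%:M x <= sqnorm_mx (A i) x.
  by move=> i; have [m] := rayleigh_min d0 (Apd i).1; exists m.
have /choice[M hM] : forall i, exists M : R, eigenvalue (A i) M /\
    forall x, sqnorm_mx (A i) x <= M * sqnorm_mx 1%:M x.
  by move=> i; have [M] := rayleigh_max d0 (Apd i).1; exists M.
have m_gt0 i : 0 < m i.
  have /eigenvalueP[v vA v0] := (hm i).1.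
  have vt0 : v^T != 0 by rewrite -trmx0 (inj_eq (@trmx_inj _ _ _)).
  have := (Apd i).2 _ vt0; rewrite /sqnorm_mx trmxK vA -scalemxAl mxE.
  have -> : (v *m v^T) ord0 ord0 = sqnorm_mx 1%:M v^T.
    by rewrite /sqnorm_mx trmxK mulmx1.
  by rewrite pmulr_lgt0 // lt_neqAle sqnorm1_ge0 andbT eq_sym;
    apply/eqP => /sqnorm1_eq0 vz; rewrite vz eqxx in vt0.
have lo i a : eigenvalue (A i) a -> m i <= a.
  exact: (eigenvalue_ge (hm i).2).
have hi i a : eigenvalue (A i) a -> a <= M i.
  exact: (eigenvalue_le (hM i).2).
have hlb : has_inf (spectrum A).
  by split; [exists (m i0), i0; exact: (hm i0).1
            |exists 0 => a [i /lo]; apply: le_trans; exact: ltW].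
have hub : has_sup (spectrum A).
  split; first by exists (m i0), i0; exact: (hm i0).1.
  (* Every [M j] is at least a positive eigenvalue, so the sum dominates each term. *)
  exists (\sum_i M i) => a [i /hi] /le_trans; apply.
  rewrite (bigD1 i) //= lerDl sumr_ge0 // => j _.
  by apply: le_trans (hi j _ (hm j).1); exact: ltW.
have lm i : lambda_min A <= m i.
  by apply: ge_inf; [exact: hlb.2|exists i; exact: (hm i).1].
have lM i : M i <= lambda_max A.
  by apply: ub_le_sup; [exact: hub.2|exists i; exact: (hM i).1].
split=> [||i x].
- pose j := [arg min_(j < i0) m j]%O.
  apply: lt_le_trans (m_gt0 j) _; apply: lb_le_inf; first exact: hlb.1.
  move=> a [i /lo]; apply: le_trans; rewrite /j; case: arg_minP => // l _; exact.
- exact: le_trans (lm i0) (le_trans (hi _ _ (hm i0).1) (lM i0)).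
split.
  by apply: le_trans ((hm i).2 x); rewrite ler_wpM2r ?sqnorm1_ge0.
by apply: le_trans ((hM i).2 x) _; rewrite ler_wpM2r ?sqnorm1_ge0.
Qed.

(** * Exchange-optimal clusterings with prescribed cluster weights *)

Section LexExchange.
Variable R : realType.

(** The minimisers of [f] form a compact set, on which [g] is then minimised. *)
Lemma compact_lex_min (N : nat) (K : set 'rV[R]_N) (f g : 'rV[R]_N -> R^o) :
  compact K -> K !=set0 -> continuous f -> continuous g ->
  exists2 v, K v & forall u, K u -> f v <= f u /\ (f u = f v -> g v <= g u).
Proof.
move=> cK K0 cf cg.
have [|v1] := @EVT_min_rV R N f K K0 cK.
  by apply: continuous_subspaceT.
rewrite inE => Kv1 minf.
pose K2 := K `&` (f @^-1` [set x | x = f v1]).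
have cK2 : compact K2.
  by apply: compact_closedI => //; apply: preimage_closed; [move=> ? _; exact: cf|exact: closed_eq].
have K20 : K2 !=set0 by exists v1.
have [|v2] := @EVT_min_rV R N g K2 K20 cK2.
  by apply: continuous_subspaceT.
rewrite inE => -[Kv2 /= fv2] ming; exists v2 => // u Ku; rewrite fv2; split.
  by apply: minf; rewrite inE.
by move=> fu; apply: ming; rewrite inE.
Qed.

(** The linear functional with coefficients [c]: column sums, cluster weights and both costs all
    take this form. *)
Definition mxpair k n (c C : 'M[R]_(k, n)) : R := \sum_i \sum_j C i j * c i j.

Lemma mxpairDr k n (c C D : 'M[R]_(k, n)) : mxpair c (C + D) = mxpair c C + mxpair c D.
Proof.
rewrite /mxpair -big_split; apply: eq_bigr => i _; rewrite -big_split.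
by apply: eq_bigr => j _; rewrite mxE mulrDl.
Qed.

Lemma mxpairZr k n (c C : 'M[R]_(k, n)) a : mxpair c (a *: C) = a * mxpair c C.
Proof.
rewrite /mxpair big_distrr; apply: eq_bigr => i _; rewrite big_distrr.
by apply: eq_bigr => j _; rewrite mxE /= mulrA.
Qed.

Lemma mxpair_delta k n (c : 'M[R]_(k, n)) i j : mxpair c (delta_mx i j) = c i j.
Proof.
rewrite /mxpair (bigD1 i) //= (bigD1 j) //= mxE !eqxx mul1r !big1 ?addr0 //.
  by move=> a /negPf ai; rewrite big1 // => b _; rewrite mxE ai mul0r.
by move=> b /negPf bj; rewrite mxE bj andbF mul0r.
Qed.

Lemma continuous_mxpair k n (c : 'M[R]_(k, n)) :
  continuous (fun v : 'rV[R]_(k * n) => mxpair c (vec_mx v) : R^o).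
Proof.
apply: continuous_big => //; first exact: add_continuous.
move=> i _; apply: continuous_big => //; first exact: add_continuous.
move=> j _; rewrite (_ : (fun v => _) =
  fun v : 'rV[R]_(k * n) => v ord0 (mxvec_index i j) * c i j).
  move=> v; apply: (@cvgMr_tmp R _ (nbhs v) _ (fun w : 'rV[R]_(k * n) => w ord0 (mxvec_index i j))).
  exact: coord_continuous.
by apply/funext => v; rewrite mxE.
Qed.

Lemma mxpair_clustering k n (C : 'M[R]_(k, n)) j0 :
  mxpair (\matrix_(i, j) (j == j0)%:R) C = \sum_i C i j0.
Proof.
apply: eq_bigr => i _; rewrite (bigD1 j0) //= mxE eqxx mulr1 big1 ?addr0 //.
by move=> j /negPf jj; rewrite mxE jj mulr0.
Qed.

Lemma mxpair_weight k n (w : 'I_n -> R) (C : 'M[R]_(k, n)) i0 :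
  mxpair (\matrix_(i, j) ((i == i0)%:R * w j)) C = \sum_j C i0 j * w j.
Proof.
rewrite /mxpair (bigD1 i0) //= [X in _ + X]big1 ?addr0 => [|i /negPf ii].
  by apply: eq_bigr => j _; rewrite mxE eqxx mul1r.
by rewrite big1 // => j _; rewrite mxE ii mul0r mulr0.
Qed.

(** Among the clusterings with the cluster weights of [C0], take one of least cost [G], ties being
    broken by [H]. Swapping some mass of [j] in cluster [i] against mass of [j'] in cluster [i']
    stays feasible, so it cannot improve the pair of costs. *)
Lemma lex_exchange k n (w : 'I_n -> R) (C0 : 'M[R]_(k, n)) (G H : 'I_k -> 'I_n -> R) :
  (forall j, 0 < w j) -> is_clustering C0 ->
  exists C : 'M[R]_(k, n), [/\ is_clustering C,
    forall i, \sum_j C i j * w j = \sum_j C0 i j * w j,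
    \sum_i \sum_j C i j * w j * G i j <= \sum_i \sum_j C0 i j * w j * G i j &
    forall i i' j j', 0 < C i j -> 0 < C i' j' ->
      G i j - G i' j <= G i j' - G i' j' /\
      (G i j - G i' j = G i j' - G i' j' -> H i j - H i' j <= H i j' - H i' j')].
Proof.
move=> w0 [C00 C01].
pose wt i0 : 'M[R]_(k, n) := \matrix_(i, j) ((i == i0)%:R * w j).
pose cl j0 : 'M[R]_(k, n) := \matrix_(i, j) (j == j0)%:R.
pose P := [set C : 'M[R]_(k, n) | [/\ forall i j, 0 <= C i j,
  forall j, mxpair (cl j) C = 1 & forall i, mxpair (wt i) C = mxpair (wt i) C0]].
pose K := [set v : 'rV[R]_(k * n) | P (vec_mx v)].
have cK : compact K.
  (* Nonnegative entries with column sums 1 lie in the unit interval; the other constraints are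
     closed. *)
  pose box := [set v : 'rV[R]_(k * n) | forall l, `[0, 1]%classic (v ord0 l)].
  have KE : K = box `&` (\bigcap_(j in setT)
      ((fun v => mxpair (cl j) (vec_mx v) : R^o) @^-1` [set x | x = 1]) `&`
      \bigcap_(i in setT)
      ((fun v => mxpair (wt i) (vec_mx v) : R^o) @^-1` [set x | x = mxpair (wt i) C0])).
    apply/seteqP; split=> v.
      move=> [v0 v1 v2]; split; last by split=> i _ /=.
      move=> l /=; case/mxvec_indexP: l => i j; rewrite in_itv/=.
      have := v0 i j; have := v1 j; rewrite mxpair_clustering (bigD1 i) //= mxE.
      move=> <- ->; rewrite /= lerDl sumr_ge0 // => a _; exact: v0.
    move=> [bv [v1 v2]]; split=> [i j|j|i]; last 2 first.
      exact: v1.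
      exact: v2.
    by have := bv (mxvec_index i j); rewrite /= in_itv/= mxE => /andP[].
  rewrite KE; apply: compact_closedI.
    by apply: (@rV_compact R _ (fun=> `[0, 1]%classic)) => i; exact: segment_compact.
  by apply: closedI; apply: closed_bigI => i _; apply: preimage_closed;
    [move=> v _; exact: continuous_mxpair|exact: closed_eq
    |move=> v _; exact: continuous_mxpair|exact: closed_eq].
have K0 : K !=set0.
  by exists (mxvec C0); rewrite /K /= mxvecK; split=> // j; rewrite mxpair_clustering.
pose gm (F : 'I_k -> 'I_n -> R) : 'M[R]_(k, n) := \matrix_(i, j) (w j * F i j).
have gmE F C : mxpair (gm F) C = \sum_i \sum_j C i j * w j * F i j.
  by apply: eq_bigr => i _; apply: eq_bigr => j _; rewrite mxE mulrA.
have [v Kv vmin] := compact_lex_min cK K0 (@continuous_mxpair _ _ (gm G))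
  (@continuous_mxpair _ _ (gm H)).
have {}vmin D : P D -> mxpair (gm G) (vec_mx v) <= mxpair (gm G) D /\
    (mxpair (gm G) D = mxpair (gm G) (vec_mx v) ->
     mxpair (gm H) (vec_mx v) <= mxpair (gm H) D).
  by move=> PD; have := vmin (mxvec D); rewrite /K /= mxvecK; apply.
have {}Kv : P (vec_mx v) by exact: Kv.
move: (vec_mx v) Kv vmin => C [Cp Ccl Cwt] vmin.
exists C; split.
- split; first exact: Cp.
  by move=> j; rewrite -(mxpair_clustering C); exact: Ccl.
- by move=> i; have := Cwt i; rewrite !mxpair_weight.
- rewrite -!gmE; apply: (vmin C0 _).1; split=> // j.
  by rewrite mxpair_clustering.
move=> i i' j j' Cij Cij'.
have [->|nii] := eqVneq i i'; first by rewrite !subrr.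
have [->|njj] := eqVneq j j'; first by [].
(* The largest mass that can be swapped without making an entry negative. *)
pose th := Num.min (C i j * w j) (C i' j' * w j').
have th0 : 0 < th by rewrite lt_min !mulr_gt0.
(* One unit of mass of [j] goes from [i] to [i'] and one unit of [j'] from [i'] to [i]; division by
   the weights turns mass into fractions. Column sums and cluster weights do not change. *)
pose E : 'M[R]_(k, n) := (w j)^-1 *: (delta_mx i' j + (-1) *: delta_mx i j) +
  (w j')^-1 *: (delta_mx i j' + (-1) *: delta_mx i' j').
have pE c : mxpair c (C + th *: E) = mxpair c C +
   th * ((w j)^-1 * (c i' j - c i j) + (w j')^-1 * (c i j' - c i' j')).
  by rewrite mxpairDr mxpairZr mxpairDr !mxpairZr !mxpairDr !mxpairZr !mxpair_delta; ring.
have gE F : mxpair (gm F) (C + th *: E) = mxpair (gm F) C +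
   th * ((F i j' - F i' j') - (F i j - F i' j)).
  rewrite pE !mxE; congr (_ + _ * _); have := w0 j; have := w0 j' => h1 h2.
  by field; rewrite !gt_eqF.
have PE : P (C + th *: E).
  split=> [p q|q|p].
  - rewrite !mxE.
    have thj : th / w j <= C i j by rewrite ler_pdivrMr // ge_min lexx.
    have thj' : th / w j' <= C i' j' by rewrite ler_pdivrMr // ge_min lexx orbT.
    have t0 : 0 <= th / w j by rewrite divr_ge0 // ltW.
    have t0' : 0 <= th / w j' by rewrite divr_ge0 // ltW.
    have Cpq := Cp p q.
    rewrite mulrDr !mulrA.
    have [pi|pi] := eqVneq p i.
      rewrite pi (negPf nii) /= in Cpq *.
      have [qj|qj] := eqVneq q j; first by rewrite qj (negPf njj) /=; lra.
      by case: (q == j') => /=; lra.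
    have [pi'|pi'] /= := eqVneq p i'; last by lra.
    have [qj'|qj'] := eqVneq q j'; last by case: (q == j) => /=; lra.
    by rewrite pi' qj' eq_sym (negPf njj) /=; lra.
  - by rewrite pE Ccl !mxE !subrr !mulr0 addr0 mulr0 addr0.
  - rewrite pE Cwt !mxE; have := w0 j; have := w0 j' => h1 h2.
    by field; rewrite !gt_eqF.
have [] := vmin _ PE; rewrite !gE lerDl pmulr_rge0 // subr_ge0 => h1 h2.
split=> // eqG; have := h2; rewrite eqG subrr mulr0 addr0 => /(_ erefl).
by rewrite lerDl pmulr_rge0 // subr_ge0.
Qed.

End LexExchange.

(* Both libraries use the notation [set x | P]: from here on it denotes finite sets. *)
Local Close Scope classical_set_scope.

(** * A Davenport-Schinzel bound for batches meeting several clusters *)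

(** Choosing from each set a letter unlike the previous one gives a word without immediate
    repetitions and without alternation [a b a b]. All positions but the last inject into pairs of a
    letter and a bit, whence length at most [2k + 1]. *)
Lemma davenport_schinzel_sets (k m : nat) (T : nat -> {set 'I_k}) :
  (forall r, (r < m)%N -> (1 < #|T r|)%N) ->
  (forall r1 r2 r3 r4 a b, (r1 < r2)%N -> (r2 < r3)%N -> (r3 < r4)%N -> (r4 < m)%N ->
     a \in T r1 -> b \in T r2 -> a \in T r3 -> b \in T r4 -> a = b) ->
  (m <= k.*2.+1)%N.
Proof.
case: m => [//|m] T2 abab.
have /card_gt0P[a0 a0T] : (0 < #|T 0%N|)%N by apply: ltn_trans (T2 0%N _).
(* For indices in range the set has two elements, so the search succeeds and the default [a] is not
   returned. *)
pose s := nat_rect (fun=> 'I_k) a0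
  (fun r a => odflt a [pick x in T r.+1 | x != a]).
have sS r : (r.+1 < m.+1)%N -> (s r.+1 \in T r.+1) && (s r.+1 != s r).
  move=> rm; rewrite /=; case: pickP => [x //|no].
  have := T2 _ rm; rewrite (cardD1 (s r)) ltnNge; case: (_ \in _) => //=.
    rewrite add1n ltnS leqn0 => /negPf; rewrite eq_card0 // => x.
    by rewrite !inE andbC no.
  rewrite add0n ltnW //= ?andbF.
  suff -> : #|[predD1 T r.+1 & s r]| = 0%N by [].
  by apply: eq_card0 => x; rewrite !inE andbC no.
have sT r : (r < m.+1)%N -> s r \in T r.
  by case: r => [//|r] /sS/andP[].
have sN r : (r.+1 < m.+1)%N -> s r.+1 != s r by move=> /sS/andP[].
pose later (r : 'I_m) := [exists r' : 'I_m.+1, (r < r')%N && (s r' == s r)].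
pose phi (r : 'I_m) := if later r then (s r.+1, false) else (s r, true).
(* A position is charged to its letter if it is the last occurrence of that
   letter; otherwise the next letter cannot have occurred before. *)
have first (r : 'I_m) q : later r -> (q < r.+1)%N -> s q <> s r.+1.
  move=> /existsP[r' /andP[rr' /eqP sr']] qr sq.
  have rm : (r.+1 < m.+1)%N by rewrite ltnS.
  have qr' : (q < r)%N.
    rewrite ltn_neqAle -ltnS qr andbT; apply/eqP => qE.
    by have := sN _ rm; rewrite -sq qE eqxx.
  have rr'' : (r.+1 < r')%N.
    rewrite ltn_neqAle rr' andbT; apply/eqP => rE.
    by have := sN _ rm; rewrite rE sr' eqxx.
  have r'm := ltn_ord r'.
  have rm' : (r < m.+1)%N by rewrite ltnW.
  have Tq : s r.+1 \in T q by rewrite -sq sT // (ltn_trans qr').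
  have Tr' : s r \in T r' by rewrite -sr' sT.
  have E := abab q r r.+1 r' _ _ qr' (ltnSn r) rr'' r'm Tq (sT _ rm') (sT _ rm) Tr'.
  by have := sN _ rm; rewrite E eqxx.
have phi_inj : injective phi.
  move=> r r'; rewrite /phi; case: ifPn => lr; case: ifPn => lr' // [] E.
    apply/val_inj/eqP => /=; case: (ltngtP r r') => // h.
      by case: (first _ r.+1 lr' _ E).
    by case: (first _ r'.+1 lr _ (esym E)).
  apply/val_inj/eqP => /=; case: (ltngtP r r') => // h.
    case/negP: lr; apply/existsP; exists (widen_ord (leqnSn m) r') => /=.
    by rewrite h E eqxx.
  case/negP: lr'; apply/existsP; exists (widen_ord (leqnSn m) r) => /=.
  by rewrite h E eqxx.
have := leq_card phi phi_inj; rewrite card_prod !card_ord card_bool muln2 //.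
Qed.

Definition in_batch k n (J : {set 'I_n}) (beta : 'I_n -> nat)
    (occ : 'I_k -> 'I_n -> bool) (r : nat) : {set 'I_k} :=
  [set a | [exists j, [&& j \in J, beta j == r & occ a j]]].

(** List the mixed batches in increasing order and read each as its set of clusters: an alternation
    among these sets would be one among points. The bound is therefore independent of [M]. *)
Lemma mixed_batches k n M (J : {set 'I_n}) (beta : 'I_n -> nat)
    (occ : 'I_k -> 'I_n -> bool) :
  (forall j1 j2 j3 j4 a b, j1 \in J -> j2 \in J -> j3 \in J -> j4 \in J ->
     (beta j1 < beta j2)%N -> (beta j2 < beta j3)%N -> (beta j3 < beta j4)%N ->
     occ a j1 -> occ b j2 -> occ a j3 -> occ b j4 -> a = b) ->
  (#|[set r : 'I_M | (1 < #|in_batch J beta occ r|)%N]| <= k.*2.+1)%N.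
Proof.
move=> abab; set mixed := fun r => (1 < #|in_batch J beta occ r|)%N.
pose s := [seq r <- iota 0 M | mixed r].
have sE : #|[set r : 'I_M | mixed r]| = size s.
  rewrite cardE /enum_mem -enumT -(size_map val) /s -val_enum_ord filter_map size_map.
  by rewrite size_map; congr (size _); apply: eq_filter => r; rewrite /= inE.
rewrite sE; apply: (@davenport_schinzel_sets _ _
  (fun q => in_batch J beta occ (nth 0%N s q))) => [q qs|].
  by have := mem_nth 0%N qs; rewrite mem_filter => /andP[].
move=> q1 q2 q3 q4 a b h12 h23 h34 h4.
have ss : sorted ltn s by rewrite sorted_filter ?iota_ltn_sorted //; exact: ltn_trans.
have nthlt p q : (p < q)%N -> (q <= q4)%N -> (nth 0%N s p < nth 0%N s q)%N.
  move=> pq q4'; have qs : (q < size s)%N by apply: leq_ltn_trans h4.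
  by apply: (sorted_ltn_nth ltn_trans 0%N ss); rewrite ?inE // (ltn_trans pq).
rewrite !inE => /existsP[j1 /and3P[J1 /eqP b1 o1]] /existsP[j2 /and3P[J2 /eqP b2 o2]].
move=> /existsP[j3 /and3P[J3 /eqP b3 o3]] /existsP[j4 /and3P[J4 /eqP b4 o4]].
apply: (abab j1 j2 j3 j4) => //; rewrite ?b1 ?b2 ?b3 ?b4 nthlt //.
- by apply: ltnW; apply: ltn_trans h34.
- exact: ltnW.
Qed.

(** * Weighted variance on the line and cutting into batches *)

Section Batches.
Variables (R : realType) (n : nat) (w t : 'I_n -> R).
Hypothesis w_gt0 : forall j, 0 < w j.
Implicit Types A B C : {set 'I_n}.

Definition wmean B : R := (\sum_(j in B) w j * t j) / (\sum_(j in B) w j).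
Definition wvar B : R := \sum_(j in B) w j * (t j - wmean B) ^+ 2.

Lemma wmeanP B : \sum_(j in B) w j * (t j - wmean B) = 0.
Proof.
have [->|[j0 jB]] := set_0Vmem B; first by rewrite big_set0.
have W : 0 < \sum_(j in B) w j.
  by rewrite (bigD1 j0) //= ltr_pwDl // sumr_ge0 // => j _; exact: ltW.
under eq_bigr do rewrite mulrBr.
by rewrite sumrB -mulr_suml /wmean mulrC divfK ?subrr // gt_eqF.
Qed.

(** Parallel axis identity: the cross term vanishes at the mean. *)
Lemma wvar_le B c : wvar B <= \sum_(j in B) w j * (t j - c) ^+ 2.
Proof.
have -> : \sum_(j in B) w j * (t j - c) ^+ 2 = wvar B +
   (\sum_(j in B) w j * (t j - wmean B)) * ((wmean B - c) *+ 2) +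
   (\sum_(j in B) w j) * (wmean B - c) ^+ 2.
  rewrite /wvar !mulr_suml -!big_split; apply: eq_bigr => j _ /=; ring.
rewrite wmeanP mul0r addr0 lerDl mulr_ge0 ?sqr_ge0 // sumr_ge0 // => j _.
exact: ltW.
Qed.

Lemma wvar_ge0 B : 0 <= wvar B.
Proof. by apply: sumr_ge0 => j _; rewrite mulr_ge0 ?sqr_ge0 // ltW. Qed.

(** Squared deviations from the mean of [C] add over disjoint pieces, and passing to the mean of
    each piece only lowers them. *)
Lemma wvar_superadd A B C : [disjoint A & B] -> A \subset C -> B \subset C ->
  wvar A + wvar B <= wvar C.
Proof.
move=> AB AC BC; have nn (D : {set 'I_n}) : 0 <= \sum_(j in D) w j * (t j - wmean C) ^+ 2.
  by apply: sumr_ge0 => j _; rewrite mulr_ge0 ?sqr_ge0 // ltW.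
rewrite [wvar C]/wvar (big_setID A) /= (finset.setIidPr AC) lerD ?wvar_le //.
rewrite (big_setID B) /= (finset.setIidPr _); last first.
  by rewrite finset.subsetD BC disjoint_sym.
by apply: le_trans (wvar_le B (wmean C)) _; rewrite lerDl.
Qed.

Lemma wvar_mono A B : A \subset B -> wvar A <= wvar B.
Proof.
move=> AB; have := @wvar_superadd A finset.set0 B; rewrite {2}/wvar big_set0 addr0.
by apply => //; rewrite ?finset.sub0set // -finset.setI_eq0 finset.setI0.
Qed.

(* The prefix variance F grows from 0 to the total variance; cutting at the
   multiples of a 1/m fraction of the total, and separating the first position
   of each piece from the rest, gives batches of small variance: the first
   position alone has variance 0, and the rest is bounded by the growth of F
   after that position. *)
Lemma batching (J : {set 'I_n}) (m : nat) :
  exists beta : 'I_n -> nat, [/\ forall j, j \in J -> (beta j < m.+1.*2)%N,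
    {in J &, forall j j', t j <= t j' -> (beta j <= beta j')%N} &
    forall r : nat, m%:R * wvar [set j in J | beta j == r] <= wvar J].
Proof.
pose pre j := [set i in J | t i <= t j].
have preJ j : pre j \subset J by apply/fintype.subsetP => i; rewrite inE => /andP[].
(* If [wvar J] is zero, so is [F], by the convention on division; the variance bound treats this
   case separately. *)
pose F j := m%:R * wvar (pre j) / wvar J.
have F0 j : 0 <= F j by rewrite !mulr_ge0 ?wvar_ge0 ?invr_ge0 ?wvar_ge0.
have Fm j : F j <= m%:R.
  have [V0|V0] := eqVneq (wvar J) 0; first by rewrite /F V0 invr0 mulr0.
  rewrite /F ler_pdivrMr ?lt_def ?V0 ?wvar_ge0 // ler_wpM2l //.
  exact: wvar_mono.
pose fl j := Num.truncn (F j).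
have flm j : (fl j <= m)%N.
  rewrite -(ler_nat R); by apply: le_trans (Fm j); rewrite truncn_le.
have flmono j j' : t j <= t j' -> (fl j <= fl j')%N.
  move=> h; apply: le_truncn; rewrite /F ler_wpM2r ?invr_ge0 ?wvar_ge0 // ler_wpM2l //.
  apply: wvar_mono; apply/fintype.subsetP => i; rewrite !inE => /andP[-> /le_trans]; exact.
pose e j := [exists i, [&& i \in J, fl i == fl j & t i < t j]].
(* Batch [2q] holds the points at the smallest position of level [q], batch [2q + 1] the others of
   that level. Level [m] can occur, hence [m + 1] levels. *)
exists (fun j => (fl j).*2 + e j)%N; split.
- move=> j _; have := flm j; case: (e j); lia.
- move=> j j' Jj Jj' h; have := flmono _ _ h; rewrite leq_eqVlt => /orP[/eqP E|]; last first.
    by case: (e j); case: (e j'); lia.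
  rewrite E leq_add2l; case ej : (e j) => //; rewrite lt0b; apply/existsP.
  move/existsP: ej => [i /and3P[Ji fi ti]]; exists i.
  by rewrite Ji -E fi (lt_le_trans ti).
move=> r; set B := [set j in J | _].
have BJ : B \subset J by apply/fintype.subsetP => i; rewrite inE => /andP[].
have [V0|V0] := eqVneq (wvar J) 0.
  have := wvar_mono BJ; rewrite V0 => h.
  by rewrite (_ : wvar B = 0) ?mulr0 //; apply/eqP; rewrite eq_le h wvar_ge0.
have [Be|[b0 Bb0]] := set_0Vmem B.
  by rewrite Be /wvar big_set0 mulr0; exact: wvar_ge0.
have VJ : 0 < wvar J by rewrite lt_def V0 wvar_ge0.
have BP i : i \in B -> [/\ i \in J, fl i = fl b0 & e i = e b0].
  move: Bb0; rewrite !inE => /andP[_ /eqP <-] /andP[-> /eqP h]; split=> //.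
    by move: h; case: (e i); case: (e b0); lia.
  by move: h; case: (e i); case: (e b0) => //; lia.
have [eb|eb] := boolP (e b0); last first.
  have tB i : i \in B -> t i = t b0.
    move=> /BP[Ji fi]; rewrite (negPf eb) => ei; have [Jb0 _ _] := BP _ Bb0.
    case: (ltgtP (t i) (t b0)) => // h.
      by case/negP: eb; apply/existsP; exists i; rewrite Ji fi eqxx.
    by move/existsP: ei => []; exists b0; rewrite Jb0 fi eqxx.
  rewrite (_ : wvar B = 0) ?mulr0 ?wvar_ge0 //; apply/eqP.
  rewrite eq_le wvar_ge0 andbT; apply: le_trans (wvar_le B (t b0)) _.
  by rewrite big1 // => i /tB ->; rewrite subrr expr0n mulr0.
have [Jb0 _ _] := BP _ Bb0.
pose cl i := (i \in J) && (fl i == fl b0).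
have Pb0 : cl b0 by rewrite /cl Jb0 eqxx.
case: (@arg_minP _ _ _ b0 cl t Pb0) => j0 /andP[Jj0 /eqP fj0] j0min.
case: (@arg_maxP _ _ _ b0 (mem B) t Bb0) => jm Bjm jmmax.
have ltB i : i \in B -> t j0 < t i.
  move=> /BP[Ji fi ei]; move: eb; rewrite -ei => /existsP[l /and3P[Jl /eqP fll tl]].
  by apply: le_lt_trans tl; apply: j0min; rewrite /cl Jl fll fi eqxx.
have sup : wvar (pre j0) + wvar B <= wvar (pre jm).
  apply: wvar_superadd.
  - rewrite disjoint_subset; apply/fintype.subsetP => i; rewrite inE => /andP[_ h].
    by rewrite inE; apply/negP => /ltB; rewrite ltNge h.
  - apply/fintype.subsetP => i; rewrite !inE => /andP[-> /le_trans]; apply.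
    exact: ltW (ltB _ Bjm).
  - by apply/fintype.subsetP => i Bi; rewrite inE (fintype.subsetP BJ) //=; exact: jmmax.
have [_ fjm _] := BP _ Bjm.
(* The points [j0] and [jm] lie on the level of [b0], so [m] times the prefix variance grows by at
   most [wvar J] between them. *)
have lo : (fl b0)%:R * wvar J <= m%:R * wvar (pre j0).
  by rewrite -ler_pdivlMr // -fj0 -/(F j0) truncn_le.
have hi : m%:R * wvar (pre jm) <= ((fl b0)%:R + 1) * wvar J.
  rewrite -ler_pdivrMr // -fjm -/(F jm) ltW // natr1; exact: truncnS_gt.
have m0 : 0 <= m%:R :> R by [].
have := ler_wpM2l m0 sup; rewrite mulrDr => h; lra.
Qed.

End Batches.

(** * Approximate centres and rounding onto grid lines *)

(** Replacing each site by the data point nearest to it costs a factor 4. With centres among the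
    data, only finitely many choices of centres and assignments remain, so a best one exists. *)
Lemma medoid_centers (R : realType) (d k n : nat) (w : 'I_n -> R) (x : 'I_n -> 'cV[R]_d) :
  (0 < k)%N -> (0 < n)%N -> (forall j, 0 < w j) ->
  exists (z : 'I_k -> 'cV[R]_d) (a : 'I_n -> 'I_k),
    forall (S : 'I_k -> 'cV[R]_d) (C : 'M[R]_(k, n)), is_clustering C ->
      \sum_j w j * sqnorm_mx 1%:M (x j - z (a j)) <=
      4%:R * \sum_i \sum_j C i j * w j * sqnorm_mx 1%:M (x j - S i).
Proof.
move=> k0 n0 w0; pose i0 := Ordinal k0; pose j0 := Ordinal n0.
pose val (p : {ffun 'I_k -> 'I_n} * {ffun 'I_n -> 'I_k}) : R :=
  \sum_j w j * sqnorm_mx 1%:M (x j - x (p.1 (p.2 j))).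
have [p _ pmin] := @arg_minP _ _ _ ([ffun=> j0], [ffun=> i0]) predT val isT.
exists (fun i => x (p.1 i)), p.2 => S C [C0 C1].
pose nz i : 'I_n := [arg min_(j < j0) sqnorm_mx 1%:M (x j - S i)]%O.
pose na j : 'I_k := [arg min_(i < i0) sqnorm_mx 1%:M (x j - S i)]%O.
apply: le_trans (pmin ([ffun i => nz i], [ffun j => na j]) isT) _.
rewrite exchange_big /= big_distrr /=; apply: ler_sum => j _ /=; rewrite !ffunE.
have nzP i : sqnorm_mx 1%:M (x (nz i) - S i) <= sqnorm_mx 1%:M (x j - S i).
  by rewrite /nz; case: arg_minP => // l _; apply.
have naP i : sqnorm_mx 1%:M (x j - S (na j)) <= sqnorm_mx 1%:M (x j - S i).
  by rewrite /na; case: arg_minP => // l _; apply.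
set b := na j in naP *; set r := sqnorm_mx 1%:M (x j - S b) in naP *.
(* Both [x j] and [x (nz b)] are within squared distance [r] of [S b]; Young with parameter 1 gives
   [2 + 2]. *)
have tri : sqnorm_mx 1%:M (x j - x (nz b)) <= 4%:R * r.
  have -> : x j - x (nz b) = (x j - S b) + (-1) *: (x (nz b) - S b).
    by rewrite scaleN1r opprB addrA subrK.
  have := @sqnorm_young _ _ 1%:M 1 (x j - S b) (-1 *: (x (nz b) - S b))
    (tr_scalar_mx _ _) (@sqnorm1_ge0 _ _) ltr01.
  by rewrite sqnormZ invr1; have := nzP b; rewrite -/r; lra.
apply: (@le_trans _ _ (w j * (4%:R * r))); first by rewrite ler_pM2l.
have {1}-> : r = \sum_i C i j * r by rewrite -mulr_suml C1 mul1r.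
rewrite mulrCA ler_pM2l // big_distrr /=.
by apply: ler_sum => i _; rewrite [C i j * w j]mulrC -mulrA ler_pM2l // ler_wpM2l.
Qed.

Section Rounding.
Variables (R : realType) (d N : nat).
Hypothesis N_gt0 : (0 < N)%N.

(** A grid point of mesh [1/N] on the facet of the cube [[-1, 1]^(d+1)] where coordinate [l0] equals
    1. Lines through the centre also take negative multiples, so opposite facets need no directions
    of their own. *)
Definition grid_dir (l0 : 'I_d.+1) (g : {ffun 'I_d -> 'I_(N.*2.+1)}) : 'cV[R]_d.+1 :=
  \col_l (if unlift l0 l is Some m then (g m : nat)%:R / N%:R - 1 else 1).

Lemma grid_dir_sqnorm l0 g : sqnorm_mx 1%:M (grid_dir l0 g) <= d.+1%:R.
Proof.
have N0 : 0 < N%:R :> R by rewrite ltr0n.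
rewrite sqnorm1E -[X in _ <= X%:R]card_ord -sum1_card natr_sum; apply: ler_sum => l _.
rewrite mxE; case: unlift => [m|]; last by rewrite expr1n.
have h : (g m : nat)%:R / N%:R <= 2%:R :> R.
  rewrite ler_pdivrMr // -natrM ler_nat mul2n -ltnS; exact: ltn_ord.
have h0 : 0 <= (g m : nat)%:R / N%:R :> R by rewrite divr_ge0.
by move: h h0; set q := _ / _ => h h0; rewrite -subr_ge0 mulr1n; nra.
Qed.

(** Divide by the coordinate [t] of largest modulus and round the ratios, which lie in [[-1, 1]],
    down to the grid: each coordinate moves by at most [|t| / N]. *)
Lemma grid_rounding (y : 'cV[R]_d.+1) : exists l0 g,
  N%:R ^+ 2 * sqnorm_mx 1%:M (y - y l0 ord0 *: grid_dir l0 g) <=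
    d.+1%:R * sqnorm_mx 1%:M y /\ y l0 ord0 ^+ 2 <= sqnorm_mx 1%:M y.
Proof.
have N0 : 0 < N%:R :> R by rewrite ltr0n.
case: (@arg_maxP _ _ _ (ord0 : 'I_d.+1) predT (fun l => `|y l ord0|) isT) => l0 _ lmax.
set t := y l0 ord0 in lmax *.
(* For [t = 0] the whole vector vanishes and the junk ratio 0 is still correct. *)
pose r l := y l ord0 / t.
have rt l : y l ord0 = r l * t.
  have [t0|t0] := eqVneq t 0; last by rewrite divfK.
  have : `|y l ord0| <= `|t| := lmax l isT.
  by rewrite t0 normr0 normr_le0 => /eqP ->; rewrite mulr0.
have r1 l : `|r l| <= 1.
  have [t0|t0] := eqVneq t 0; first by rewrite /r t0 invr0 mulr0 normr0.
  by rewrite normrM normfV ler_pdivrMr ?normr_gt0 // mul1r; exact: lmax.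
pose h l := Num.truncn (N%:R * (r l + 1)).
have hP l : (h l)%:R <= N%:R * (r l + 1) /\ N%:R * (r l + 1) < (h l)%:R + 1.
  have /ler_normlP[h1 h2] := r1 l; split.
    by rewrite truncn_le mulr_ge0 //; lra.
  by rewrite natr1 truncnS_gt.
have hN l : (h l < N.*2.+1)%N.
  rewrite ltnS -(ler_nat R); apply: le_trans (hP l).1 _.
  by rewrite -mul2n natrM mulrC ler_wpM2r //; have /ler_normlP[h1 h2] := r1 l; lra.
exists l0, [ffun m => Ordinal (hN (lift l0 m))].
have t2 : t ^+ 2 <= sqnorm_mx 1%:M y.
  rewrite sqnorm1E (bigD1 l0) //= lerDl sumr_ge0 // => l _; exact: sqr_ge0.
split=> //; apply: (@le_trans _ _ (d.+1%:R * t ^+ 2)); last first.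
  by rewrite ler_wpM2l.
rewrite sqnorm1E big_distrr /= -[X in _ <= X%:R * _]card_ord -sum1_card natr_sum big_distrl /=.
apply: ler_sum => l _; rewrite !mxE -exprMn mul1r.
case: unliftP => [m ->|->]; last first.
  by rewrite mulr1 -/t subrr mulr0 expr0n sqr_ge0.
rewrite ffunE /= rt; have [h1 h2] := hP (lift l0 m).
move: (r _) h1 h2 => q; move: (h _)%:R => c h1 h2.
have -> : N%:R * (q * t - t * (c / N%:R - 1)) = t * (N%:R * (q + 1) - c).
  by field; rewrite gt_eqF.
rewrite exprMn -[leRHS]mulr1 ler_wpM2l ?sqr_ge0 //.
by move: (N%:R * _) h1 h2 => e h1 h2; nra.
Qed.

End Rounding.

(** * Merging batches into their centroids *)

Section Merging.
Variables (R : realType) (d k n m : nat) (w : 'I_n -> R) (x : 'I_n -> 'cV[R]_d).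
Variable (p : 'I_n -> 'I_m).
Hypothesis w_gt0 : forall j, 0 < w j.
Hypothesis p_surj : forall b, exists j, p j = b.

(** Weights and points are separate arguments, so one formula covers the data, their moved copies
    and the merged points. *)
Definition pcost (n' : nat) (A : 'I_k -> 'M[R]_d) (v : 'I_n' -> R)
    (z : 'I_n' -> 'cV[R]_d) (C : 'M[R]_(k, n')) (S : 'I_k -> 'cV[R]_d) : R :=
  \sum_i \sum_j C i j * v j * sqnorm_mx (A i) (z j - S i).

Definition batch_weight b : R := \sum_(j | p j == b) w j.
Definition centroid b : 'cV[R]_d :=
  (batch_weight b)^-1 *: \sum_(j | p j == b) w j *: x j.
Definition batch_var b : R :=
  \sum_(j | p j == b) w j * sqnorm_mx 1%:M (x j - centroid b).
(** [pull] will be the coreset map [f], and [push] carries a clustering of the data to the merged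
    points. Both preserve cluster weights, hence the weight bounds. *)
Definition pull (C : 'M[R]_(k, m)) : 'M[R]_(k, n) := \matrix_(i, j) C i (p j).
Definition push (C : 'M[R]_(k, n)) : 'M[R]_(k, m) :=
  \matrix_(i, b) ((\sum_(j | p j == b) C i j * w j) / batch_weight b).

Lemma batch_weight_gt0 b : 0 < batch_weight b.
Proof.
have [j pj] := p_surj b; rewrite /batch_weight (bigD1 j) /= ?pj ?eqxx //.
by rewrite ltr_pwDl // sumr_ge0 // => i _; exact: ltW.
Qed.

(** Weighted deviations from the centroid sum to zero, which kills the cross term. The last sum does
    not contain [s]: this makes the change of cost independent of the sites. *)
Lemma centroid_sqnorm (A : 'M[R]_d) b s : A^T = A ->
  \sum_(j | p j == b) w j * sqnorm_mx A (x j - s) =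
  batch_weight b * sqnorm_mx A (centroid b - s) +
  \sum_(j | p j == b) w j * sqnorm_mx A (x j - centroid b).
Proof.
move=> As; set y := centroid b.
have y0 : \sum_(j | p j == b) w j *: (x j - y) = 0.
  under eq_bigr do rewrite scalerBr.
  rewrite sumrB -scaler_suml -/(batch_weight b) /y /centroid scalerA.
  by rewrite mulfV ?scale1r ?subrr // gt_eqF // batch_weight_gt0.
have -> : \sum_(j | p j == b) w j * sqnorm_mx A (x j - s) =
    \sum_(j | p j == b) (w j * sqnorm_mx A (y - s) +
      (w j * bilin A (x j - y) (y - s)) *+ 2 + w j * sqnorm_mx A (x j - y)).
  apply: eq_bigr => j _; have -> : x j - s = (x j - y) + (y - s) by rewrite addrA subrK.
  by rewrite sqnormD //; ring.
rewrite !big_split /= -mulr_suml bilin_suml y0.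
by rewrite /bilin trmx0 !mul0mx mxE !addr0.
Qed.

Lemma batch_var_le b s : batch_var b <= \sum_(j | p j == b) w j * sqnorm_mx 1%:M (x j - s).
Proof.
rewrite (centroid_sqnorm b s (tr_scalar_mx _ _)) lerDr mulr_ge0 ?sqnorm1_ge0 //.
exact: ltW (batch_weight_gt0 b).
Qed.

Lemma batch_var_ge0 b : 0 <= batch_var b.
Proof. by apply: sumr_ge0 => j _; rewrite mulr_ge0 ?sqnorm1_ge0 // ltW. Qed.

Lemma pull_clustering C : is_clustering C -> is_clustering (pull C).
Proof.
move=> [C0 C1]; split=> [i j|j]; first by rewrite mxE.
by under eq_bigr do rewrite mxE.
Qed.

Lemma pull_weight C i :
  \sum_j pull C i j * w j = \sum_b C i b * batch_weight b.
Proof.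
rewrite (partition_big p predT) //=; apply: eq_bigr => b _.
by rewrite big_distrr /=; apply: eq_bigr => j /eqP <-; rewrite mxE.
Qed.

Lemma push_clustering C : is_clustering C -> is_clustering (push C).
Proof.
move=> [C0 C1]; split=> [i b|b].
  rewrite mxE divr_ge0 ?(ltW (batch_weight_gt0 b)) // sumr_ge0 // => j _.
  by rewrite mulr_ge0 // ltW.
under eq_bigr do rewrite mxE.
rewrite -mulr_suml exchange_big /=.
under eq_bigr do rewrite -mulr_suml C1 mul1r.
by rewrite mulfV // gt_eqF // batch_weight_gt0.
Qed.

Lemma push_weight C i :
  \sum_b push C i b * batch_weight b = \sum_j C i j * w j.
Proof.
rewrite [RHS](partition_big p predT) //=; apply: eq_bigr => b _.
by rewrite mxE divfK // gt_eqF // batch_weight_gt0.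
Qed.

Variables (A : 'I_k -> 'M[R]_d) (l L : R).
Hypothesis A_sym : forall i, (A i)^T = A i.
Hypothesis l_gt0 : 0 < l.
Hypothesis A_lo : forall i z, l * sqnorm_mx 1%:M z <= sqnorm_mx (A i) z.
Hypothesis A_hi : forall i z, sqnorm_mx (A i) z <= L * sqnorm_mx 1%:M z.

Lemma form_ge0 i z : 0 <= sqnorm_mx (A i) z.
Proof. by apply: le_trans (A_lo i z); rewrite mulr_ge0 ?sqnorm1_ge0 // ltW. Qed.

(** A pulled-back clustering is constant on batches, so the cost grows by a convex combination over
    [i] of the variances with respect to [A i], each at most [L * batch_var b]. *)
Lemma pull_cost C S : is_clustering C ->
  pcost A w x (pull C) S <= pcost A batch_weight centroid C S + L * \sum_b batch_var b.
Proof.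
move=> [C0 C1]; rewrite /pcost.
have -> : \sum_i \sum_j pull C i j * w j * sqnorm_mx (A i) (x j - S i) =
  \sum_i \sum_b (C i b * batch_weight b * sqnorm_mx (A i) (centroid b - S i) +
    C i b * \sum_(j | p j == b) w j * sqnorm_mx (A i) (x j - centroid b)).
  apply: eq_bigr => i _; rewrite (partition_big p predT) //=; apply: eq_bigr => b _.
  rewrite -mulrA -mulrDr -centroid_sqnorm // big_distrr /=.
  by apply: eq_bigr => j /eqP <-; rewrite mxE mulrA.
under eq_bigr do rewrite big_split /=.
rewrite big_split /= lerD2l exchange_big /= big_distrr /=; apply: ler_sum => b _.
rewrite -[leRHS]mul1r -(C1 b) mulr_suml; apply: ler_sum => i _.
rewrite ler_wpM2l // big_distrr /=; apply: ler_sum => j _.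
by rewrite mulrCA ler_pM2l.
Qed.

Definition mixed (C : 'M[R]_(k, n)) b : bool :=
  (1 < #|[set i | [exists j, (p j == b) && (0 < C i j)%R]]|)%N.

(** On a batch within one cluster the centroid identity is exact and gains at least
    [l * batch_var b]. On a mixed batch Young's inequality, applied point by point, loses
    [(1 + al^-1) * L * batch_var b]. *)
Lemma push_cost (C : 'M[R]_(k, n)) S (al : R) : is_clustering C -> 0 < al ->
  pcost A batch_weight centroid (push C) S + l * \sum_b batch_var b <=
  (1 + al) * pcost A w x C S + (2%:R + al^-1) * L * \sum_(b | mixed C b) batch_var b.
Proof.
move=> [C0 C1] al0.
pose bc (y : 'I_n -> 'cV[R]_d) b : R :=
    \sum_i \sum_(j | p j == b) C i j * w j * sqnorm_mx (A i) (y j - S i).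
have -> : pcost A batch_weight centroid (push C) S = \sum_b bc (fun j => centroid b) b.
  rewrite /pcost exchange_big; apply: eq_bigr => b _; apply: eq_bigr => i _.
  rewrite mxE divfK ?mulr_suml //; by rewrite gt_eqF // batch_weight_gt0.
have -> : pcost A w x C S = \sum_b bc x b.
  by rewrite exchange_big; apply: eq_bigr => i _; rewrite (partition_big p predT).
rewrite !big_distrr -big_split /= [X in _ <= _ + X]big_mkcond /= -big_split /=.
apply: ler_sum => b _.
have bc0 : 0 <= bc x b.
  apply: sumr_ge0 => i _; apply: sumr_ge0 => j _; rewrite mulr_ge0 ?form_ge0 //.
  by rewrite mulr_ge0 // ltW.
case: ifPn => [_|pure].
  (* The term with [l] on the left is also charged to [L] here, which turns [1 + al^-1] into
     [2 + al^-1]. *)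
  have lL : l * batch_var b <= L * batch_var b.
    rewrite /batch_var !big_distrr /=; apply: ler_sum => j _.
    rewrite [leLHS]mulrCA [leRHS]mulrCA ler_pM2l //.
    case: (pickP (fun _ : 'I_k => true)) => [i1 _|no]; last first.
      by have := C1 j; rewrite big_pred0 // => /esym/eqP; rewrite oner_eq0.
    exact: le_trans (A_lo i1 _) (A_hi i1 _).
  suff : bc (fun=> centroid b) b <= (1 + al) * bc x b + (1 + al^-1) * (L * batch_var b).
    by move: lL; rewrite -[X in _ -> _ -> _ <= _ + X]mulrA; set a := al^-1; lra.
  rewrite /bc exchange_big /= [X in _ <= _ * X + _]exchange_big /= /batch_var !big_distrr /=.
  rewrite -big_split /=; apply: ler_sum => j /eqP pj.
  have -> : (1 + al^-1) * (L * (w j * sqnorm_mx 1%:M (x j - centroid b))) =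
      \sum_i C i j * ((1 + al^-1) * (L * (w j * sqnorm_mx 1%:M (x j - centroid b)))).
    by rewrite -mulr_suml C1 mul1r.
  rewrite big_distrr -big_split /=; apply: ler_sum => i _.
  have := @sqnorm_young _ _ (A i) al (x j - S i) (-1 *: (x j - centroid b)) (A_sym i) (form_ge0 i) al0.
  have -> : x j - S i + -1 *: (x j - centroid b) = centroid b - S i.
    by rewrite scaleN1r opprB addrC addrA subrK.
  rewrite sqnormZ sqrrN expr1n mul1r => h.
  have := A_hi i (x j - centroid b) => h2.
  have a0 : 0 < 1 + al^-1 by rewrite addr_gt0 // invr_gt0.
  have {h2} := ler_wpM2l (ltW a0) h2 => h2.
  have cw : 0 <= C i j * w j by rewrite mulr_ge0 // ltW.
  apply: le_trans (ler_wpM2l cw (le_trans h (lerD (lexx _) h2))) _.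
  by rewrite le_eqVlt; apply/orP; left; apply/eqP; ring.
have [j0 pj0] := p_surj b.
have [i0 Ci0] : exists i0, 0 < C i0 j0.
  apply/existsP; apply: contraT; rewrite negb_exists => /forallP h.
  have := C1 j0; rewrite big1 => [/esym/eqP|i _]; first by rewrite oner_eq0.
  by apply/eqP; rewrite eq_le C0 leNgt h.
have pureC j i : p j = b -> i != i0 -> C i j = 0.
  move=> pj ii; apply/eqP; rewrite eq_le C0 andbT leNgt; apply: contra pure => Cij.
  rewrite /mixed (cardD1 i0) (cardD1 i) !inE ii.
  have -> : [exists j1, (p j1 == b) && (0 < C i0 j1)].
    by apply/existsP; exists j0; rewrite pj0 eqxx.
  have -> : [exists j1, (p j1 == b) && (0 < C i j1)].
    by apply/existsP; exists j; rewrite pj eqxx.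
  by [].
have one j : p j = b -> C i0 j = 1.
  move=> pj; rewrite -(C1 j) (bigD1 i0) //= big1 ?addr0 // => i ii; exact: pureC.
have bcE y : bc y b = \sum_(j | p j == b) w j * sqnorm_mx (A i0) (y j - S i0).
  rewrite /bc (bigD1 i0) //= [X in _ + X]big1 ?addr0 => [|i ii].
    by apply: eq_bigr => j /eqP pj; rewrite one // mul1r.
  by rewrite big1 // => j /eqP pj; rewrite pureC // !mul0r.
apply: (@le_trans _ _ (bc x b)); last by rewrite addr0 ler_peMl // lerDl ltW.
rewrite !bcE (centroid_sqnorm _ _ (A_sym i0)) -mulr_suml lerD2l.
by rewrite /batch_var big_distrr; apply: ler_sum => j _; rewrite /= mulrCA ler_pM2l.
Qed.

End Merging.

(** * Batches along lines and alternation of clusters *)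

(** Keeping only the labels that occur makes every batch nonempty, so that its weight is positive
    and its centroid meaningful. *)
Lemma surjective_labels (T : finType) (n : nat) (f : 'I_n -> T) :
  exists (m : nat) (p : 'I_n -> 'I_m) (r : 'I_m -> T),
    [/\ (m <= #|T|)%N, forall b, exists j, p j = b, injective r & forall j, r (p j) = f j].
Proof.
pose s := undup (codom f).
have fs j : f j \in s by rewrite mem_undup codom_f.
have idx j : (index (f j) s < size s)%N by rewrite index_mem.
exists (size s), (fun j => Ordinal (idx j)), (fun b => tnth (in_tuple s) b).
have us : uniq s := undup_uniq _; split=> [|b|b b'|j].
- rewrite -(card_uniqP us); exact: max_card.
- have : tnth (in_tuple s) b \in s by exact: mem_tnth.
  rewrite mem_undup => /codomP[j fj]; exists j; apply: val_inj => /=.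
  by rewrite -fj (tnth_nth (f j)) /= index_uniq.
- have x0 := tnth (in_tuple s) b; rewrite !(tnth_nth x0) /= => /eqP.
  by rewrite nth_uniq // => /eqP /val_inj.
- by rewrite (tnth_nth (f j)) /= nth_index.
Qed.

(* The second differences at t1 < t2 < t3 and at t2 < t3 < t4 force the
   quadratic to be constant; then the tie-breaking inequalities force h = 0. *)
Lemma quadratic_alternation (R : realType) (e2 e1 e0 h t1 t2 t3 t4 : R)
    (D := fun t : R => e2 * t ^+ 2 + e1 * t + e0) :
  t1 < t2 -> t2 < t3 -> t3 < t4 ->
  D t1 <= D t2 -> D t3 <= D t2 -> D t3 <= D t4 ->
  (D t1 = D t2 -> h * t1 <= h * t2) -> (D t3 = D t2 -> h * t3 <= h * t2) -> h = 0.
Proof.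
move=> h12 h23 h34 D12 D32 D34 E12 E32.
have e2le : e2 <= 0.
  have id : e2 * ((t2 - t1) * (t3 - t2) * (t3 - t1)) =
    (t3 - t2) * (D t1 - D t2) + (t2 - t1) * (D t3 - D t2) by rewrite /D; ring.
  have : e2 * ((t2 - t1) * (t3 - t2) * (t3 - t1)) <= 0.
    by rewrite id -[0]addr0 lerD // mulr_ge0_le0 //; lra.
  by rewrite pmulr_lle0 // !mulr_gt0 //; lra.
have e2ge : 0 <= e2.
  have id : e2 * ((t3 - t2) * (t4 - t3) * (t4 - t2)) =
    (t4 - t3) * (D t2 - D t3) + (t3 - t2) * (D t4 - D t3) by rewrite /D; ring.
  have : 0 <= e2 * ((t3 - t2) * (t4 - t3) * (t4 - t2)).
    by rewrite id addr_ge0 // mulr_ge0 //; lra.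
  by rewrite pmulr_lge0 // !mulr_gt0 //; lra.
have e20 : e2 = 0 by apply/eqP; rewrite eq_le e2le e2ge.
move: D12 D32 D34 E12 E32; rewrite /D e20 !mul0r !add0r !lerD2r => D12 D32 _.
have e10 : e1 = 0.
  by apply/eqP; rewrite eq_le; apply/andP; split; nra.
by rewrite e10 !mul0r => /(_ erefl) h1 /(_ erefl) h2; nra.
Qed.

Section LineBatches.
Variables (R : realType) (d k n : nat) (w : 'I_n -> R) (I : finType).
Variables (line : 'I_n -> I) (c u : I -> 'cV[R]_d) (t : 'I_n -> R) (M : nat) (e : R).
Hypothesis w_gt0 : forall j, 0 < w j.
Hypothesis u_le : forall i, sqnorm_mx 1%:M (u i) <= e.
Let x j := c (line j) + t j *: u (line j).

(** The conclusion of [lex_exchange] with tie-breaking cost [i * t j]. Its slopes differ for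
    distinct clusters, which settles the case where two site costs differ by a constant along a
    line. *)
Definition exchange_optimal (A : 'I_k -> 'M[R]_d) (S : 'I_k -> 'cV[R]_d) (C : 'M[R]_(k, n)) :=
  let G i j := sqnorm_mx (A i) (x j - S i) in
  let H (i : 'I_k) j := (i : nat)%:R * t j in
  forall i i' j j', 0 < C i j -> 0 < C i' j' ->
    G i j - G i' j <= G i j' - G i' j' /\
    (G i j - G i' j = G i j' - G i' j' -> H i j - H i' j <= H i j' - H i' j').

(** On one line [G a - G b] is a quadratic in [t], and optimality at the four points supplies the
    inequalities of [quadratic_alternation] with [h = a - b]. *)
Lemma exchange_no_alternation A S C : (forall i, (A i)^T = A i) ->
  exchange_optimal A S C ->
  forall j1 j2 j3 j4 a b, line j2 = line j1 -> line j3 = line j1 -> line j4 = line j1 ->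
    t j1 < t j2 -> t j2 < t j3 -> t j3 < t j4 ->
    0 < C a j1 -> 0 < C b j2 -> 0 < C a j3 -> 0 < C b j4 -> a = b.
Proof.
move=> As opt j1 j2 j3 j4 a b l2 l3 l4 t12 t23 t34 C1 C2 C3 C4.
set ct := c (line j1); set ut := u (line j1).
pose e2 := sqnorm_mx (A a) ut - sqnorm_mx (A b) ut.
pose e1 := (bilin (A a) (ct - S a) ut - bilin (A b) (ct - S b) ut) *+ 2.
pose e0 := sqnorm_mx (A a) (ct - S a) - sqnorm_mx (A b) (ct - S b).
pose G i j := sqnorm_mx (A i) (x j - S i).
have GE j : line j = line j1 -> G a j - G b j = e2 * t j ^+ 2 + e1 * t j + e0.
  move=> lj; have Gi i : G i j = sqnorm_mx (A i) (ct - S i) +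
      t j * bilin (A i) (ct - S i) ut *+ 2 + t j ^+ 2 * sqnorm_mx (A i) ut.
    have xE : x j - S i = (ct - S i) + t j *: ut by rewrite /x lj addrAC.
    by rewrite /G xE (sqnormD _ (t j *: ut) (As i)) bilinZr sqnormZ.
  by rewrite !Gi /e2 /e1 /e0; ring.
have HE j : (a : nat)%:R * t j - (b : nat)%:R * t j = ((a : nat)%:R - (b : nat)%:R) * t j.
  by rewrite mulrBl.
have [D12 E12] := opt _ _ _ _ C1 C2.
have [D32 E32] := opt _ _ _ _ C3 C2.
have [D34 _] := opt _ _ _ _ C3 C4.
move: D12 E12 D32 E32 D34; rewrite -!/(G _ _) !HE !GE // => D12 E12 D32 E32 D34.
have := quadratic_alternation t12 t23 t34 D12 D32 D34 E12 E32.
move/eqP; rewrite subr_eq0 eqr_nat => /eqP; exact: val_inj.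
Qed.

(** The partition is fixed before [A], [S] and [C], so it serves all sites at once. On each line at
    most [2k + 1] batches are mixed, each carrying at most [1/M] of the variance of that line. *)
Lemma line_batches :
  exists (m : nat) (p : 'I_n -> 'I_m),
  [/\ (m <= #|I| * M.+1.*2)%N, forall b, exists j, p j = b &
    forall A S C, (forall i, (A i)^T = A i) -> exchange_optimal A S C ->
      M%:R * \sum_(b | mixed p C b) batch_var w x p b <=
      (k.*2.+1)%:R * (e * \sum_j w j * t j ^+ 2)].
Proof.
pose J i : {set 'I_n} := [set j | line j == i].
have /choice[beta betaP] := fun i => batching t w_gt0 (J i) M.
have Jl j : j \in J (line j) by rewrite inE.
have blt j : (beta (line j) j < M.+1.*2)%N by have [+ _ _] := betaP (line j); exact.
pose lab j : I * 'I_(M.+1.*2) := (line j, Ordinal (blt j)).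
have [m [p [r [mle psurj rinj rp]]]] := surjective_labels lab.
exists m, p; split=> // [|A S C As opt].
  by move: mle; rewrite card_prod card_ord.
pose v i := wvar w t (J i).
have e_ge0 b : mixed p C b -> 0 <= e.
  by move=> _; apply: le_trans (u_le (r b).1); exact: sqnorm1_ge0.
have pE b j : (p j == b) = (j \in [set j in J (r b).1 | beta (r b).1 j == (r b).2]).
  rewrite 2!inE -(inj_eq rinj) rp; case: (r b) => i q; rewrite /lab xpair_eqE /=.
  by case: eqP => //= <-.
have bv b : mixed p C b -> M%:R * batch_var w x p b <= e * v (r b).1.
  move=> mb; have [_ _ /(_ (r b).2) hv] := betaP (r b).1.
  set B := [set j in _ | _] in hv; have e0 := e_ge0 b mb.
  apply: le_trans (ler_wpM2l e0 hv); rewrite mulrCA ler_wpM2l //.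
  (* Comparison with the point of the line at parameter [wmean] reduces the batch variance to a
     one-dimensional one. *)
  apply: le_trans (batch_var_le x w_gt0 psurj b (c (r b).1 + wmean w t B *: u (r b).1)) _.
  rewrite /wvar big_distrr /=.
  rewrite (eq_bigl (mem B)) => [|j]; last by rewrite pE.
  apply: ler_sum => j; rewrite !inE => /andP[/eqP lj _]; rewrite /x lj.
  rewrite opprD addrACA subrr add0r -scalerBl sqnormZ mulrA mulrC.
  by rewrite ler_wpM2r // mulr_ge0 ?sqr_ge0 // ltW.
rewrite big_distrr /=; apply: le_trans (ler_sum _ bv) _.
rewrite (partition_big (fun b => (r b).1) predT) //= !big_distrr /=.
have -> : \sum_j (k.*2.+1)%:R * (e * (w j * t j ^+ 2)) =
    \sum_i \sum_(j in J i) (k.*2.+1)%:R * (e * (w j * t j ^+ 2)).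
  rewrite (partition_big line predT) //=; apply: eq_bigr => i _.
  by apply: eq_bigl => j; rewrite inE.
apply: ler_sum => i _.
under eq_bigr => b /andP[_ /eqP ->] do over.
rewrite sumr_const -!mulr_sumr -[leLHS]mulr_natl.
case: (pickP (fun b => mixed p C b)) => [b0 mb0|no]; last first.
  rewrite (_ : #|_| = 0%N) ?mul0r; last first.
    by apply: eq_card0 => b; have nb := no b; rewrite /= in nb; rewrite unfold_in /= nb.
  by rewrite mulr_ge0 // mulr_ge0 //; [exact: le_trans (sqnorm1_ge0 _) (u_le i)|
    rewrite sumr_ge0 // => j _; rewrite mulr_ge0 ?sqr_ge0 // ltW].
have e0 := e_ge0 _ mb0.
have vi : v i <= \sum_(j in J i) w j * t j ^+ 2.
  by apply: le_trans (wvar_le t w_gt0 (J i) 0) _; under eq_bigr do rewrite subr0.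
apply: ler_pM => //; [by rewrite mulr_ge0 // wvar_ge0| |by rewrite ler_wpM2l].
rewrite ler_nat; pose occ (a : 'I_k) j := 0 < C a j.
have [_ bmono _] := betaP i.
apply: leq_trans (@mixed_batches k n M.+1.*2 (J i) (beta i) occ _).
  (* Batches on line [i] are determined by the second component of their label. *)
  rewrite -(card_in_image (f := fun b => (r b).2)) => [|b b']; last first.
    rewrite !unfold_in /= => /andP[_ /eqP h] /andP[_ /eqP h'] rr; apply: rinj.
    by move: h h' rr; case: (r b) => ? ?; case: (r b') => ? ? /= -> -> ->.
  apply: subset_leq_card; apply/fintype.subsetP => q /fintype.imageP[b].
  rewrite unfold_in /= => /andP[mb /eqP rb] ->; rewrite inE; apply: leq_trans mb _.
  apply: subset_leq_card; apply/fintype.subsetP => a; rewrite !inE => /existsP[j /andP[pj Caj]].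
  by apply/existsP; exists j; rewrite /occ Caj andbT -rb; move: pj; rewrite pE inE.
have tlt j j' : j \in J i -> j' \in J i -> (beta i j < beta i j')%N -> t j < t j'.
  by move=> Jj Jj'; rewrite !ltNge ltnNge; apply: contra; exact: bmono.
move=> j1 j2 j3 j4 a b J1 J2 J3 J4 b12 b23 b34 o1 o2 o3 o4.
move: (J1) (J2) (J3) (J4); rewrite !inE => /eqP l1 /eqP l2 /eqP l3 /eqP l4.
by apply: (exchange_no_alternation As opt _ _ _ (tlt _ _ J1 J2 b12) (tlt _ _ J2 J3 b23)
  (tlt _ _ J3 J4 b34) o1 o2 o3 o4); rewrite ?l1.
Qed.

End LineBatches.

(** * Error estimates and assembly of the coreset *)

Lemma pcost_ge0 (R : realType) (d k n : nat) (A : 'I_k -> 'M[R]_d) (w : 'I_n -> R)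
    (x : 'I_n -> 'cV[R]_d) (C : 'M[R]_(k, n)) S :
  (forall j, 0 < w j) -> (forall i z, 0 <= sqnorm_mx (A i) z) -> is_clustering C ->
  0 <= pcost A w x C S.
Proof.
move=> w0 A0 [C0 _]; apply: sumr_ge0 => i _; apply: sumr_ge0 => j _.
by rewrite mulr_ge0 // mulr_ge0 // ltW.
Qed.

Lemma pcost_perturb (R : realType) (d k n : nat) (A : 'I_k -> 'M[R]_d) (w : 'I_n -> R)
    (x y : 'I_n -> 'cV[R]_d) (C : 'M[R]_(k, n)) S (L al : R) :
  (forall j, 0 < w j) -> (forall i, (A i)^T = A i) ->
  (forall i z, 0 <= sqnorm_mx (A i) z) ->
  (forall i z, sqnorm_mx (A i) z <= L * sqnorm_mx 1%:M z) ->
  is_clustering C -> 0 < al ->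
  pcost A w y C S <= (1 + al) * pcost A w x C S +
    (1 + al^-1) * L * \sum_j w j * sqnorm_mx 1%:M (y j - x j).
Proof.
move=> w0 As A0 AL [C0 C1] al0.
have -> : \sum_j w j * sqnorm_mx 1%:M (y j - x j) =
    \sum_i \sum_j C i j * w j * sqnorm_mx 1%:M (y j - x j).
  rewrite exchange_big; apply: eq_bigr => j _; rewrite /=.
  by under [RHS]eq_bigr do rewrite -mulrA; rewrite -mulr_suml C1 mul1r.
rewrite /pcost !big_distrr -big_split; apply: ler_sum => i _.
rewrite !big_distrr -big_split; apply: ler_sum => j _ /=.
have cw : 0 <= C i j * w j by rewrite mulr_ge0 // ltW.
have a0 : 0 <= 1 + al^-1 by rewrite addr_ge0 // invr_ge0 ltW.
have -> : y j - S i = (x j - S i) + (y j - x j) by rewrite [RHS]addrC addrA subrK.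
have h := le_trans (sqnorm_young (x j - S i) (y j - x j) (As i) (A0 i) al0)
  (lerD (lexx _) (ler_wpM2l a0 (AL i (y j - x j)))).
apply: le_trans (ler_wpM2l cw h) _.
by rewrite le_eqVlt; apply/orP; left; apply/eqP; ring.
Qed.

(** The arithmetic shared by two estimates: moving the points onto lines, with [K = N^2], and
    merging mixed batches, with [K = M]. In both the error [e] is small against [D], and [D] is
    controlled by the cost [P]. *)
Lemma error_budget (R : realFieldType) (a h b g eps rho l K e D P : R) :
  0 < eps -> 0 < K -> 0 < l -> 0 <= rho -> 0 <= h -> 0 <= b -> 0 <= D -> 0 <= e -> 0 <= P ->
  a * eps <= h -> K * e <= b * D -> l * D <= 4%:R * P ->
  4%:R * h * rho * b <= g * K * eps ^+ 2 -> a * (rho * l) * e <= eps * g * P.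
Proof.
move=> eps0 K0 l0 rho0 h0 b0 D0 e0 P0 ah Ke lD hb.
rewrite -(ler_pM2l (mulr_gt0 K0 eps0)).
have rl : 0 <= rho * l by rewrite mulr_ge0 // ltW.
have s1 : a * eps * (rho * l * (K * e)) <= h * (rho * l * (b * D)).
  apply: (@le_trans _ _ (h * (rho * l * (K * e)))).
    by rewrite ler_wpM2r // mulr_ge0 // mulr_ge0 // ltW.
  by rewrite ler_wpM2l // ler_wpM2l.
have s2 : h * rho * b * (l * D) <= h * rho * b * (4%:R * P).
  by rewrite ler_wpM2l // !mulr_ge0.
have s3 := ler_wpM2r P0 hb.
apply: (@le_trans _ _ (a * eps * (rho * l * (K * e)))).
  by rewrite le_eqVlt; apply/orP; left; apply/eqP; ring.
apply: le_trans s1 _; apply: (@le_trans _ _ (h * rho * b * (l * D))).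
  by rewrite le_eqVlt; apply/orP; left; apply/eqP; ring.
apply: le_trans s2 _; apply: (@le_trans _ _ (4%:R * h * rho * b * P)).
  by rewrite le_eqVlt; apply/orP; left; apply/eqP; ring.
by apply: le_trans s3 _; rewrite le_eqVlt; apply/orP; left; apply/eqP; ring.
Qed.

Local Open Scope classical_set_scope.

Lemma cost_le (R : realType) (d k : nat) (A : 'I_k -> 'M[R]_d)
    (Kmin Kmax : 'I_k -> \bar R) (X : weighted_data R d) S C :
  (forall i z, 0 <= sqnorm_mx (A i) z) ->
  clusterings Kmin Kmax X C -> cost A Kmin Kmax X S <= cost_at A C S.
Proof.
move=> A0 XC; apply: ge_inf; last by exists C.
exists 0 => _ [C' [clC' _] <-].
exact: (@pcost_ge0 _ _ _ _ A (@wd_weight _ _ X) (@wd_point _ _ X) C' S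
  (@wd_weight_gt0 _ _ X) A0 clC').
Qed.

(** Serves the case of empty [X], where no data point can act as a centre. *)
Lemma coreset_refl (R : realType) (d k : nat) (A : 'I_k -> 'M[R]_d)
    (Kmin Kmax : 'I_k -> \bar R) (eps delta : R) (X : weighted_data R d) :
  (forall i z, 0 <= sqnorm_mx (A i) z) -> 0 <= eps ->
  clusterings Kmin Kmax X !=set0 -> is_coreset eps delta A Kmin Kmax X X.
Proof.
move=> A0 eps0 Xn; split=> //; exists id, 0, 0; split=> //; first by rewrite mulr0 lexx.
have pos C S : clusterings Kmin Kmax X C -> 0 <= cost_at A C S.
  move=> [clC _]; exact: (@pcost_ge0 _ _ _ _ A (@wd_weight _ _ X)
    (@wd_point _ _ X) C S (@wd_weight_gt0 _ _ X) A0 clC).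
move=> S C XC; rewrite !addr0; split.
  by rewrite ler_piMl ?pos // gerBl.
rewrite ler_peMl ?lerDl //; apply: lb_le_inf.
  by case: Xn => C' XC'; exists (cost_at A C' S), C'.
by move=> _ [C' XC' <-]; exact: pos.
Qed.

(** The hypothesis on [N] limits the error of moving points onto lines to [eps/8] of the cost, the
    one on [M] the error of mixed batches to [eps/4]. *)
Lemma coreset_of_grid (R : realType) (d k : nat) (X : weighted_data R d.+1)
    (A : 'I_k -> 'M[R]_d.+1) (Kmin Kmax : 'I_k -> \bar R) (eps delta rho : R)
    (N M : nat) :
  (0 < k)%N -> (forall i, sym_posdef (A i)) ->
  clusterings Kmin Kmax X !=set0 -> 0 < eps -> eps <= 2^-1 ->
  rho = lambda_max A / lambda_min A -> rho <= delta -> (0 < N)%N -> (0 < M)%N ->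
  512%:R * d.+1%:R * rho <= N%:R ^+ 2 * eps ^+ 2 ->
  80%:R * rho * (k.*2.+1)%:R * d.+1%:R <= eps ^+ 2 * M%:R ->
  exists Y : weighted_data R d.+1, is_coreset eps delta A Kmin Kmax X Y /\
    (wd_size Y <= k * (d.+1 * N.*2.+1 ^ d) * M.+1.*2)%N.
Proof.
move=> k0 Apd Xn eps0 eps2 rhoE rhod N0 M0 Nbig Mbig.
have [l0 lL bnd] := spectrum_bounds (ltn0Sn d) k0 Apd.
set l := lambda_min A in l0 lL bnd rhoE *; set L := lambda_max A in lL bnd rhoE *.
have As i := (Apd i).1.
have Alo i z := (bnd i z).1; have Ahi i z := (bnd i z).2.
have A0 i z : 0 <= sqnorm_mx (A i) z := form_ge0 l0 Alo i z.
have [n0|n0] := posnP (wd_size X).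
  by exists X; split; [apply: coreset_refl => //; exact: ltW|rewrite n0].
set n := wd_size X in n0 *; pose w : 'I_n -> R := @wd_weight _ _ X.
pose x : 'I_n -> 'cV[R]_d.+1 := @wd_point _ _ X.
have w0 j : 0 < w j by exact: wd_weight_gt0.
have [z [a za]] := @medoid_centers R d.+1 k n w x k0 n0 w0.
set D := \sum_j _ in za.
have D0 : 0 <= D by apply: sumr_ge0 => j _; rewrite mulr_ge0 ?sqnorm1_ge0 // ltW.
(* [D] is the yardstick for all errors: it is controlled by the cost of any clustering with any
   sites. *)
have lD C S : is_clustering C -> l * D <= 4%:R * pcost A w x C S.
  move=> clC; apply: le_trans (ler_wpM2l (ltW l0) (za S C clC)) _.
  rewrite mulrCA ler_pM2l // /pcost big_distrr; apply: ler_sum => i _.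
  rewrite big_distrr; apply: ler_sum => j _; rewrite /= mulrCA ler_wpM2l //.
  by rewrite mulr_ge0 ?clC.1 // ltW.
have /choice[l0f /choice[g gP]] := fun j => grid_rounding N0 (x j - z (a j)).
pose line j : 'I_k * ('I_d.+1 * {ffun 'I_d -> 'I_(N.*2.+1)}) := (a j, (l0f j, g j)).
pose c (i : 'I_k * ('I_d.+1 * {ffun 'I_d -> 'I_(N.*2.+1)})) := z i.1.
pose u (i : 'I_k * ('I_d.+1 * {ffun 'I_d -> 'I_(N.*2.+1)})) : 'cV[R]_d.+1 := grid_dir R i.2.1 i.2.2.
pose t j := (x j - z (a j)) (l0f j) ord0.
pose x' j := c (line j) + t j *: u (line j).
have u_le i : sqnorm_mx 1%:M (u i) <= d.+1%:R by exact: grid_dir_sqnorm.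
have [m [p [mle psurj pV]]] := @line_batches R d.+1 k n w _ line c u t M d.+1%:R w0 u_le.
pose E := \sum_j w j * sqnorm_mx 1%:M (x' j - x j).
have ND : N%:R ^+ 2 * E <= d.+1%:R * D.
  rewrite /E /D !big_distrr; apply: ler_sum => j _ /=.
  rewrite mulrCA [leRHS]mulrCA ler_pM2l //.
  have -> : sqnorm_mx 1%:M (x' j - x j) =
      sqnorm_mx 1%:M ((x j - z (a j)) - t j *: grid_dir R (l0f j) (g j)).
    rewrite -[x' j - x j]opprK -scaleN1r sqnormZ sqrrN expr1n mul1r; congr sqnorm_mx.
    by rewrite /x' /c /u /= opprB opprD addrA.
  exact: (gP j).1.
have tD : \sum_j w j * t j ^+ 2 <= D.
  by apply: ler_sum => j _; rewrite ler_pM2l //; exact: (gP j).2.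
have E0 : 0 <= E by apply: sumr_ge0 => j _; rewrite mulr_ge0 ?sqnorm1_ge0 // ltW.
have Lr : L = rho * l by rewrite rhoE divfK // gt_eqF.
have rho0 : 0 <= rho by rewrite rhoE divr_ge0 ?(ltW l0) // (le_trans (ltW l0)).
have NR : 0 < N%:R :> R by rewrite ltr0n.
have MR : 0 < M%:R :> R by rewrite ltr0n.
have al8 : 0 < eps / 8%:R by lra.
have al4 : 0 < eps / 4%:R by lra.
(* Here [(1 + 8/eps) * eps <= 16], and [4 * 16 * 8] gives the 512 in the bound on [N]. *)
have noise C S : is_clustering C ->
    (1 + (eps / 8%:R)^-1) * L * E <= eps / 8%:R * pcost A w x C S.
  move=> clC; have P0 := pcost_ge0 x S w0 A0 clC; have := lD C S clC.
  move=> lDP; rewrite Lr; apply: (error_budget (h := 16%:R) (K := N%:R ^+ 2)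
    (b := d.+1%:R) _ _ l0 rho0 _ _ D0 E0 P0 _ ND lDP) => //.
  - by rewrite exprn_gt0.
  - by rewrite mulrDl mul1r invf_div divfK ?gt_eqF //; lra.
  - by move: Nbig; rewrite -[8%:R^-1 * _ * _]mulrA;
      move: (N%:R ^+ 2 * _) (rho) (d.+1%:R) => r1 r2 r3; lra.
have near C S : is_clustering C ->
    pcost A w x' C S <= (1 + eps / 4%:R) * pcost A w x C S /\
    (1 - eps) * pcost A w x C S <= pcost A w x' C S.
  move=> clC; have P0 := pcost_ge0 x S w0 A0 clC; have P0' := pcost_ge0 x' S w0 A0 clC.
  have nz := noise C S clC.
  have := pcost_perturb x' x S w0 As A0 Ahi clC al8.
  have := pcost_perturb x x' S w0 As A0 Ahi clC al8.
  rewrite -/E (_ : \sum_j w j * sqnorm_mx 1%:M (x j - x' j) = E); last first.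
    apply: eq_bigr => j _; congr (_ * _).
    by rewrite -opprB -scaleN1r sqnormZ sqrrN expr1n mul1r.
  move: nz P0 P0'; move: (_ * L * E) (pcost _ _ _ _ _) (pcost _ _ _ _ _) => T P P' h1 h2 h3 h4 h5.
  split; first by lra.
  (* The reverse perturbation gives [(1 - eps/8) P <= (1 + eps/8) P'], and
     [(1 - eps)(1 + eps/8) <= 1 - eps/8]. *)
  by rewrite -(ler_pM2l (_ : 0 < 1 + eps / 8%:R)); [nra|lra].
pose Y := WeightedData (centroid w x' p) (batch_weight_gt0 w0 psurj).
pose V := \sum_b batch_var w x' p b.
have V0 : 0 <= V by apply: sumr_ge0 => b _; exact: batch_var_ge0.
have pushY C : clusterings Kmin Kmax X C -> clusterings Kmin Kmax Y (push w p C).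
  move=> [clC Kc]; split=> [|i]; first exact: (push_clustering w0 psurj).
  by rewrite /cluster_weight (push_weight w0 psurj).
have pullX C : clusterings Kmin Kmax Y C -> clusterings Kmin Kmax X (pull p C).
  move=> [clC Kc]; split=> [|i]; first exact: pull_clustering.
  have := pull_weight w p C i; rewrite /cluster_weight => ->; exact: Kc.
exists Y; split; last first.
  apply: leq_trans mle _; rewrite !card_prod card_ffun !card_ord; exact: leqnn.
split; first by case: Xn => C XC; exists (push w p C); exact: pushY.
(* The quotient of the two shifts is [rho], which is where [delta] must be at least the eigenvalue
   ratio. *)
exists (pull p), (L * V), (l * V); split=> //.
  apply/andP; split; first by rewrite mulr_ge0 // (le_trans (ltW l0)).
  by rewrite mulrA ler_wpM2r // Lr ler_wpM2r // ltW.
move=> S C YC; split.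
  have [clC _] := pullX _ YC.
  apply: le_trans (near _ S clC).2 _.
  exact: (pull_cost x' w0 psurj As Ahi S YC.1).
have eps1 : 0 < 1 + eps by lra.
rewrite -ler_pdivrMl //; apply: lb_le_inf.
  by case: Xn => C' XC'; exists (cost_at A C' S), C'.
move=> _ [C0 [clC0 KC0] <-]; rewrite ler_pdivrMl //.
pose G i j := sqnorm_mx (A i) (x' j - S i).
pose H (i : 'I_k) j := (i : nat)%:R * t j.
(* An arbitrary competitor [C0] on [X] is replaced by an exchange-optimal clustering of the moved
   points with the same cluster weights, to which the count of mixed batches applies. *)
have [C1 [clC1 wC1 C1le opt]] := lex_exchange G H w0 clC0.
have XC1 : clusterings Kmin Kmax X C1.
  by split=> // i; have := KC0 i; rewrite /cluster_weight -wC1.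
have cY := cost_le S A0 (pushY _ XC1).
have := push_cost x' w0 psurj As l0 Alo Ahi S clC1 al4.
set Q := \sum_(b | mixed p C1 b) _; rewrite -/V => pc.
have {}pV : M%:R * Q <= (k.*2.+1)%:R * (d.+1%:R * D).
  apply: le_trans (pV A S C1 As opt) _.
  by rewrite ler_wpM2l // ler_wpM2l.
have Q0 : 0 <= Q by apply: sumr_ge0 => b _; exact: batch_var_ge0.
have [P'le _] := near C0 S clC0; have lDC := lD C0 S clC0.
have P0 := pcost_ge0 x S w0 A0 clC0.
change (@cost_at R d.+1 k A X C0 S) with (pcost A w x C0 S).
change (@cost_at R d.+1 k A Y (push w p C1) S) with
  (pcost A (batch_weight w p) (centroid w x' p) (push w p C1) S) in cY.
have P1le : pcost A w x' C1 S <= pcost A w x' C0 S by exact: C1le.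
(* Here [(2 + 4/eps) * eps <= 5], and [4 * 5 * 4] gives the 80 in the bound on [M]. *)
have Qle : (2%:R + (eps / 4%:R)^-1) * L * Q <= eps / 4%:R * pcost A w x C0 S.
  rewrite Lr; apply: (error_budget (h := 5%:R) (K := M%:R)
    (b := (k.*2.+1)%:R * d.+1%:R) _ _ l0 rho0 _ _ D0 Q0 P0 _ _ lDC) => //.
  - by rewrite mulr_ge0.
  - by rewrite mulrDl invf_div divfK ?gt_eqF //; lra.
  - by rewrite -mulrA.
  - move: Mbig; rewrite (_ : 80%:R * rho * _ * _ =
      80%:R * (rho * (k.*2.+1%:R * d.+1%:R))); last by ring.
    rewrite -[4%:R * 5%:R * _ * _]mulrA -[4%:R^-1 * _ * _]mulrA [M%:R * _]mulrC.
    by move: (eps ^+ 2 * _) (rho * _) => r1 r2; lra.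
apply: le_trans (lerD cY (lexx _)) (le_trans pc _); apply: le_trans (lerD (lexx _) Qle) _.
have {}P1le := le_trans P1le P'le.
have a4 : 0 <= 1 + eps / 4%:R by lra.
apply: le_trans (lerD (ler_wpM2l a4 P1le) (lexx _)) _.
move: P0; move: (pcost A w x C0 S) => P P0.
have e4 : 0 <= 4%:R - eps by lra.
(* The total factor [(1 + eps/4)^2 + eps/4] is at most [1 + eps]. *)
by have := mulr_ge0 (mulr_ge0 P0 (ltW eps0)) e4; lra.
Qed.

(** * Choice of the parameters and the size count *)

Lemma truncnS_le (R : realType) (y : R) : 1 <= y -> (Num.truncn y).+1%:R <= 2%:R * y.
Proof.
move=> y1; have y0 : 0 <= y by lra.
have h : (Num.truncn y)%:R <= y by rewrite truncn_le.
by rewrite -natr1; lra.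
Qed.

(* The constant of the O-notation depends on the dimension d and, through a
   nondecreasing function c, on the ratio lambda_max / lambda_min only: not on
   k, eps, delta, the bounds, the points, the weights or their number. A
   dependence on the ratio cannot be avoided: for d = 1, k = 2, matrices 1 and
   L, X a fine grid of [0, 1] of total weight 1, and cluster 2 of weight
   exactly w = L^(-1/3), letting s_2 run through [0, 1] in the second coreset
   inequality forces order 1 / w coreset points. *)
Theorem theorem2p3 (R : realType) (d : nat) (d_gt0 : (0 < d)%N) :
  exists c : R -> R, {homo c : x y / x <= y} /\
    forall (k : nat) (X : weighted_data R d) (A : 'I_k -> 'M[R]_d)
        (Kmin Kmax : 'I_k -> \bar R) (eps delta : R),
      (0 < k)%N ->
      (forall i, sym_posdef (A i)) ->
      weight_bounds Kmin Kmax ->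
      clusterings Kmin Kmax X !=set0 ->
      0 < eps -> eps <= 2^-1 ->
      lambda_max A / lambda_min A <= delta ->
      exists Y : weighted_data R d,
        is_coreset eps delta A Kmin Kmax X Y /\
        (wd_size Y)%:R <=
          c (lambda_max A / lambda_min A) * (k%:R ^+ 2 / eps ^+ d.+1).
Proof.
have dbl3 a : (0 < a)%N -> (a.*2.+1 <= 3 * a)%N by lia.
have dbl4 a : (0 < a)%N -> (a.+1.*2 <= 4 * a)%N by lia.
case: d d_gt0 => [//|d] _; set e : R := d.+1%:R.
have e1 : 1 <= e by rewrite ler1n.
(* Up to powers of [rho], [k] and [1/eps], the factors bound the choices of the leading coordinate,
   the [2N + 1] grid values in each of [d] coordinates, and the [2(M + 1)] batches per line. *)
pose K : R := e * (3%:R * (1024%:R * e)) ^+ d * (4%:R * (480%:R * e)).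
have K0 : 0 <= K by rewrite /K !mulr_ge0 ?exprn_ge0 ?mulr_ge0 //; lra.
(* The maximum with 1 makes the function nondecreasing on all reals; the eigenvalue ratio is at
   least 1 and is not changed by it. *)
exists (fun r => K * Num.max 1 r ^+ d.+1); split=> [r s rs|].
  have m0 x : 0 <= Num.max 1 x :> R by rewrite le_max ler01.
  by rewrite ler_wpM2l // lerXn2r ?nnegrE ?m0 // ge_max !le_max lexx rs orbT.
move=> k X A Kmin Kmax eps delta k0 Apd _ Xn eps0 eps2 rd.
have [l0 lL _] := spectrum_bounds (ltn0Sn d) k0 Apd.
have [rho rhoE] : exists r, r = lambda_max A / lambda_min A by eexists.
rewrite -rhoE in rd *.
have rho1 : 1 <= rho by rewrite rhoE ler_pdivlMr // mul1r.
have k1 : 1 <= k%:R :> R by rewrite ler1n.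
have i1 : 1 <= eps^-1 by rewrite invf_ge1 //; lra.
pose N := (Num.truncn (512%:R * e * rho * eps^-1)).+1.
(* The 240 is 80 times 3, from [2k + 1 <= 3k]; rounding up at most doubles a number that is at least
   1. *)
pose M := (Num.truncn (240%:R * rho * k%:R * e * eps^-1 ^+ 2)).+1.
have mul_ge1 (a b : R) : 1 <= a -> 1 <= b -> 1 <= a * b by move=> *; nra.
have Ny1 : 1 <= 512%:R * e * rho * eps^-1 by rewrite !mul_ge1 //; lra.
have My1 : 1 <= 240%:R * rho * k%:R * e * eps^-1 ^+ 2.
  by rewrite expr2 !mul_ge1 //; lra.
have Nle : N%:R <= 1024%:R * e * rho * eps^-1.
  by apply: le_trans (truncnS_le Ny1) _; lra.
have Mle : M%:R <= 480%:R * rho * k%:R * e * eps^-1 ^+ 2.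
  by apply: le_trans (truncnS_le My1) _; lra.
have Nge : 512%:R * e * rho <= N%:R * eps.
  by rewrite -ler_pdivrMr // ltW // truncnS_gt.
have Mge : 240%:R * rho * k%:R * e <= M%:R * eps ^+ 2.
  by rewrite -ler_pdivrMr ?exprn_gt0 // -exprVn ltW // truncnS_gt.
(* As [N * eps >= 1], its square dominates it, so a bound linear in [rho] suffices. *)
have Nbig : 512%:R * d.+1%:R * rho <= N%:R ^+ 2 * eps ^+ 2.
  rewrite -exprMn -/e; apply: (le_trans Nge); rewrite expr2 ler_peMr //.
    by rewrite mulr_ge0 // ltW.
  by apply: (le_trans _ Nge); rewrite !mul_ge1 //; lra.
have Mbig : 80%:R * rho * (k.*2.+1)%:R * d.+1%:R <= eps ^+ 2 * M%:R.
  rewrite [leRHS]mulrC -/e; apply: le_trans Mge; rewrite ler_wpM2r ?(le_trans ler01) //.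
  have -> : (k.*2.+1)%:R = 2%:R * k%:R + 1 :> R by rewrite -natr1 -mul2n natrM.
  by nra.
have [Y [cY Yn]] := coreset_of_grid (N := N) (M := M) k0 Apd Xn eps0 eps2 rhoE rd
  isT isT Nbig Mbig.
exists Y; split=> //.
have rhom : Num.max 1 rho = rho by apply/max_idPr.
rewrite rhom; move: Yn; rewrite -(ler_nat R) => /le_trans; apply.
have N3 : (N.*2.+1)%:R <= 3%:R * (1024%:R * e) * (rho * eps^-1).
  apply: (@le_trans _ _ (3%:R * N%:R)); last by lra.
  by rewrite -natrM ler_nat; exact: dbl3.
have M4 : (M.+1.*2)%:R <= 4%:R * (480%:R * e) * (rho * k%:R * eps^-1 ^+ 2).
  apply: (@le_trans _ _ (4%:R * M%:R)); last by lra.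
  by rewrite -natrM ler_nat; exact: dbl4.
(* The lines contribute [k * (rho/eps)^d] and the batches per line [rho * k / eps^2]. The dimension
   being [d + 1] here, the exponent [d + 2] of [1/eps] is the required one. *)
rewrite !natrM natrX -/e.
apply: (@le_trans _ _ (k%:R * (e * (3%:R * (1024%:R * e) * (rho * eps^-1)) ^+ d) *
    (4%:R * (480%:R * e) * (rho * k%:R * eps^-1 ^+ 2)))).
  apply: ler_pM => //; first by rewrite !mulr_ge0 ?exprn_ge0 //; lra.
  rewrite ler_wpM2l // ler_wpM2l ?(le_trans ler01 e1) //.
  by rewrite lerXn2r ?nnegrE // (le_trans _ N3).
rewrite le_eqVlt; apply/orP; left; apply/eqP.
rewrite /K exprMn [(rho * eps^-1) ^+ d]exprMn -exprVn !exprS expr0; ring.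
Qed.
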